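(* Assume $\lambda_0=\lambda_{\min}(\mathbf H^\infty)>0$ and let $\mathbf H^\infty=\sum_{i=1}^n\lambda_i\mathbf v_i\mathbf v_i^\top$ be an eigen-decomposition with orthonormal eigenvectors $\mathbf v_1,\dots,\mathbf v_n$. There are universal constants $c,C>0$ such that for every $\epsilon>0$ and $\delta\in(0,1)$ the following holds. If $\kappa\le c\,\frac{\epsilon\delta}{\sqrt n}$, $m\ge C\max\left\{\frac{n^7}{\lambda_0^4\kappa^2\delta^4\epsilon^2},\frac{n^6}{\lambda_0^4\kappa^2\delta^3}\right\}$ and $\eta\le c\,\frac{\lambda_0}{n^2}$, then with probability at least $1-\delta$ over the random initialization, for all iterations $k\ge 0$, $$\|\mathbf u(k)-\mathbf y\|_2=\sqrt{\sum_{i=1}^n(1-\eta\lambda_i)^{2k}(\mathbf v_i^\top\mathbf y)^2}\;\pm\;\epsilon .$$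
   Context: Setting: $n$ inputs $\mathbf x_1,\dots,\mathbf x_n\in\mathbb R^d$ with $\|\mathbf x_i\|_2=1$ and labels $y_1,\dots,y_n\in\mathbb R$ with $|y_i|\le1$; $\mathbf y=(y_1,\dots,y_n)^\top$. Let $\sigma(z)=\max\{z,0\}$. A two-layer network of width $m$ is $f_{\mathbf W,\mathbf a}(\mathbf x)=\frac1{\sqrt m}\sum_{r=1}^m a_r\sigma(\mathbf w_r^\top\mathbf x)$ with $\mathbf W=(\mathbf w_1,\dots,\mathbf w_m)\in\mathbb R^{d\times m}$, $\mathbf a\in\mathbb R^m$. Initialization: independently, $\mathbf w_r(0)\sim\mathcal N(\mathbf 0,\kappa^2\mathbf I)$ and $a_r\sim\mathrm{unif}\{-1,1\}$, where $0<\kappa\le1$. The second layer $\mathbf a$ is kept fixed and the first layer is trained by gradient descent with step size $\eta>0$ on $\Phi(\mathbf W)=\frac12\sum_{i=1}^n(y_i-f_{\mathbf W,\mathbf a}(\mathbf x_i))^2$, using the update $\mathbf w_r(k+1)=\mathbf w_r(k)-\eta\frac{a_r}{\sqrt m}\sum_{i=1}^n(u_i(k)-y_i)\,\mathbb I\{\mathbf w_r(k)^\top\mathbf x_i\ge0\}\,\mathbf x_i$, where $u_i(k)=f_{\mathbf W(k),\mathbf a}(\mathbf x_i)$ and $\mathbf u(k)=(u_1(k),\dots,u_n(k))^\top$. The Gram matrix $\mathbf H^\infty\in\mathbb R^{n\times n}$ is $\mathbf H^\infty_{ij}=\mathbb E_{\mathbf w\sim\mathcal N(\mathbf 0,\mathbf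 I)}[\mathbf x_i^\top\mathbf x_j\,\mathbb I\{\mathbf w^\top\mathbf x_i\ge0,\mathbf w^\top\mathbf x_j\ge0\}]=\frac{\mathbf x_i^\top\mathbf x_j(\pi-\arccos(\mathbf x_i^\top\mathbf x_j))}{2\pi}$. The notation $a=b\pm\epsilon$ means $|a-b|\le\epsilon$. *)

(* Defs.v *)
From HB Require Import structures.
From mathcomp Require Import all_boot all_order all_algebra.
From mathcomp Require Import all_classical all_reals all_analysis.
From mathcomp Require Import Rstruct Rstruct_topology.
From mathcomp Require Import normal_distribution.
Set Implicit Arguments. Unset Strict Implicit. Unset Printing Implicit Defensive.
Import Order.TTheory GRing.Theory Num.Theory.
Local Open Scope classical_set_scope.
Local Open Scope ring_scope.

Notation RR := Rdefinitions.R.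

Definition dotv (d : nat) (a b : 'I_d -> RR) : RR := \sum_(j < d) a j * b j.

Definition relu (z : RR) : RR := Num.max z 0.

Definition net (m d : nat) (a : 'I_m -> RR) (W : 'I_m -> 'I_d -> RR)
    (x : 'I_d -> RR) : RR :=
  (Num.sqrt (m%:R))^-1 * \sum_(r < m) a r * relu (dotv (W r) x).

Fixpoint gd_iter (n m d : nat) (eta : RR) (x : 'I_n -> 'I_d -> RR)
    (y : 'I_n -> RR) (a : 'I_m -> RR) (W0 : 'I_m -> 'I_d -> RR) (k : nat)
    : 'I_m -> 'I_d -> RR :=
  match k with
  | 0 => W0
  | k'.+1 =>
    let W := gd_iter eta x y a W0 k' in
    fun r j => W r j - eta * (a r / Num.sqrt (m%:R)) *
      \sum_(i < n) (net a W (x i) - y i) *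
         (if 0 <= dotv (W r) (x i) then 1 else 0) * x i j
  end.

Definition u_pred (n m d : nat) (eta : RR) (x : 'I_n -> 'I_d -> RR)
    (y : 'I_n -> RR) (a : 'I_m -> RR) (W0 : 'I_m -> 'I_d -> RR) (k : nat)
    (i : 'I_n) : RR :=
  net a (gd_iter eta x y a W0 k) (x i).

Definition norm2 (n : nat) (v : 'I_n -> RR) : RR := Num.sqrt (\sum_(i < n) v i ^+ 2).

(* Gram matrix H^infty (closed form) *)
Definition Hinf (n d : nat) (x : 'I_n -> 'I_d -> RR) : 'M[RR]_n :=
  \matrix_(i, j) (dotv (x i) (x j) * (pi - acos (dotv (x i) (x j))) / (2 * pi)).

Definition mutually_independent {dT : measure_display} {T : measurableType dT}
    (P : probability T RR) (I : finType) (X : I -> T -> RR) : Prop :=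
  forall B : I -> set RR, (forall i, @measurable _ (measurableTypeR RR) (B i)) ->
    P (\bigcap_(i in [set: I]) (X i @^-1` B i)) =
    (\big[*%E/1%E]_(i : I) P (X i @^-1` B i))%E.

(* Main.v *)
Require Import Defs.
From HB Require Import structures.
From mathcomp Require Import all_boot all_order all_algebra.
From mathcomp Require Import all_classical all_reals all_analysis.
From mathcomp Require Import Rstruct Rstruct_topology.
From mathcomp Require Import normal_distribution measurable_realfun.
From mathcomp Require Import ring lra.
Set Implicit Arguments. Unset Strict Implicit. Unset Printing Implicit Defensive.
Import Order.TTheory GRing.Theory Num.Theory.
Import HBNNSimple.
Local Open Scope classical_set_scope.
Local Open Scope ring_scope.

(** With z(k) = u(k) - y, one step of gradient descent reads
    z(k+1) = (I - eta H) z(k) + e(k) with H = H^infty.  The error e(k) has two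
    sources: the Gram matrix at initialization differs from H, and a few neurons
    may change their activation pattern on some input.  A neuron whose initial
    pre-activation exceeds the distance travelled by its weight vector keeps its
    pattern, and relu is linear along its step; hence |e(k)| <= eta omega |z(k)|
    with omega <= lambda_0 / 2.  So |z(k)| decreases geometrically, the weights
    travel a bounded distance, and z(k) stays within |u(0)| + omega |z(0)| / lambda_0
    of the exact linear iteration (I - eta H)^k (- y), whose norm is the square
    root in the theorem.

    It remains to bound |u(0)|, the deviation of the initial Gram matrix from H
    and the number of neurons with a small pre-activation.  Each is controlled by
    a first or second moment and Markov's inequality.  These moments require the
    joint law of two projections of a Gaussian vector, which follows from the
    rotation invariance of the planar Gaussian measure, and the probability of a
    Gaussian wedge, which is additive and nonnegative in the angle, hence linear. *)

(** * Rotation invariance of the planar Gaussian measure *)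

(** Two bounds need each other: |z(k)| decreases only if few neurons flip, and few neurons flip only
    if the weights stay near their start, which rests on the decrease of |z(k)|. A radius [rad],
    fixed before the draw from the bound 6 sqrt(n / delta) that |z(0)| satisfies on the good event,
    cuts the circle. The flips counted are the neurons whose initial pre-activation is at most [rad]
    in absolute value, a function of the initialization alone; what remains is a deterministic
    induction on k.

    Here omega has order n^3 / (sqrt m delta^(3/2) lambda_0 kappa). Its two uses give the two terms
    of the maximum: omega <= lambda_0 / 2 costs n^6, and omega |z(0)| / lambda_0 <= eps / 2 costs
    n^7. The condition on kappa keeps |u(0)| within the other half of eps.

    The initialization is described by the laws of single coordinates and by independence on boxes,
    not as a product measure. Joint laws are therefore rebuilt one coordinate at a time, and
    functions of disjoint groups of coordinates are shown independent through generated
    sigma-algebras. *)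

Lemma lebesgue_measure_shift (R : realType) (c : R) (A : set R) :
  measurable A ->
  pushforward lebesgue_measure ((fun x => x + c) : _ -> measurableTypeR R) A =
  lebesgue_measure A.
Proof.
move=> mA; apply/esym/lebesgue_measure_unique => //=.
  by apply: measurable_funD.
move=> mf _ [[a b]] _ <-.
rewrite /pushforward.
have -> : (fun x : R => x + c) @^-1` `]a, b] = `]a - c, b - c]%classic :> set R.
  by apply/seteqP; split=> z /=; rewrite !in_itv/= ltrBlDr lerBrDr.
rewrite !lebesgue_measure_itv/= !lte_fin ltrD2r; case: ifP => // _.
by rewrite -!EFinD; congr EFin; ring.
Qed.

Lemma ge0_integral_shift (R : realType) (c : R) (f : measurableTypeR R -> \bar R) :
  measurable_fun setT f -> (forall x, 0 <= f x)%E ->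
  (\int[lebesgue_measure]_x f (x + c)%R = \int[lebesgue_measure]_x f x)%E.
Proof.
move=> mf f0.
have mc : measurable_fun setT ((fun x => x + c) : measurableTypeR R -> measurableTypeR R).
  by apply: measurable_funD.
transitivity (\int[pushforward lebesgue_measure
   ((fun x => x + c)%R : measurableTypeR R -> measurableTypeR R)]_x f x)%E.
  by rewrite (ge0_integral_pushforward mc).
by apply: eq_measure_integral => A mA _; exact: lebesgue_measure_shift.
Qed.


(** On an indicator this is the definition of [normal_prob]; it extends to simple functions by
    linearity and to the limit by monotone convergence on both sides. *)
Lemma ge0_integral_normal_prob (R : realType) (k : R) (f : measurableTypeR R -> \bar R) :
  measurable_fun setT f -> (forall x, 0 <= f x)%E ->
  (\int[normal_prob 0 k]_x f x =
   \int[lebesgue_measure]_x (f x * (normal_pdf 0 k x)%:E))%E.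
Proof.
move=> mf f0.
have mp : measurable_fun [set: measurableTypeR R]
    (fun x => (normal_pdf 0 k x)%:E) by
  apply/measurable_EFinP; exact: measurable_normal_pdf.
have p0 x : (0 <= (normal_pdf 0 k x)%:E)%E by rewrite lee_fin normal_pdf_ge0.
pose f_ := nnsfun_approx measurableT mf.
have step (g : {nnsfun _ >-> R}) :
    (\int[normal_prob 0 k]_x (g x)%:E =
   \int[lebesgue_measure]_x ((g x)%:E * (normal_pdf 0 k x)%:E))%E.
  under [LHS]eq_integral do rewrite fimfunE -fsumEFin//.
  rewrite [LHS]ge0_integral_fsum//; last 2 first.
  - by move=> r; exact/measurable_EFinP/measurableT_comp.
  - by move=> n x _; rewrite EFinM nnfun_muleindic_ge0.
  under [RHS]eq_integral.
    move=> x xD; rewrite fimfunE -fsumEFin// muleC ge0_mule_fsumr; last first.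
      by move=> r; rewrite EFinM nnfun_muleindic_ge0.
    over.
  rewrite [RHS]ge0_integral_fsum//; last 2 first.
  - move=> r; apply: emeasurable_funM => //.
    by apply/measurable_EFinP; do 2 apply/measurableT_comp => //.
  - by move=> n x _; rewrite EFinM mule_ge0// nnfun_muleindic_ge0.
  apply: eq_fsbigr => r _; rewrite integralZl_indic_nnsfun//.
  have [r0|r0] := ltP r 0.
    rewrite preimage_nnfun0// [X in (_ * X)%E = _]integral0_eq; last first.
      by move=> x _; rewrite indicE in_set0.
    rewrite mule0; apply/esym.
    by rewrite integral0_eq// => x _; rewrite indicE in_set0 mulr0 mule0.
  rewrite integral_indic//= setIT /normal_prob integral_mkcond.
  rewrite -ge0_integralZl_EFin//; first last.
  - by apply/(measurable_restrictT _ _).1 => //; exact: measurable_funTS.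
  - by move=> x _; rewrite patchE; case: ifP.
  apply: eq_integral => x _; rewrite patchE indicE.
  by case: ifP => _; rewrite ?mulr1 ?mulr0 ?mule0// muleC.
transitivity (limn (fun n => \int[normal_prob 0 k]_x (f_ n x)%:E))%E.
  rewrite -monotone_convergence//=.
  - apply: eq_integral => ? /[!inE] xD; apply/esym/cvg_lim => //=.
    exact: cvg_nnsfun_approx.
  - by move=> n; exact/measurable_EFinP/measurable_funTS.
  - by move=> n ? _; rewrite lee_fin.
  - by move=> ? _ ? ? mn; rewrite lee_fin; exact/lefP/nd_nnsfun_approx.
rewrite (_ : (fun n => _) = (fun n => \int[lebesgue_measure]_x ((f_ n x)%:E * (normal_pdf 0 k x)%:E)))%E; last first.
  by apply/funext => n; exact: step.
rewrite -monotone_convergence//=.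
- apply: eq_integral => x _; apply/cvg_lim => //=.
  apply: cvgeZr => //; exact: cvg_nnsfun_approx.
- move=> n; apply: emeasurable_funM => //; exact/measurable_EFinP/measurable_funTS.
- by move=> n x _; rewrite mule_ge0// lee_fin.
- by move=> x _ a b mn; rewrite lee_wpmul2r// lee_fin; exact/lefP/nd_nnsfun_approx.
Qed.

Section rotation.
Variables (R : realType).
Local Notation mR := (measurableTypeR R).
Local Notation mu := (@lebesgue_measure R).
Local Open Scope ereal_scope.

(** Tonelli makes the integral over x the inner one; with y fixed the shear is a translation of
    x. *)
Lemma ge0_integral_shear1 (s : R) (f : mR * mR -> \bar R) :
  measurable_fun setT f -> (forall z, 0 <= f z) ->
  \int[mu]_x \int[mu]_y f ((x + s * y)%R, y) = \int[mu]_x \int[mu]_y f (x, y).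
Proof.
move=> mf f0.
have ms : measurable_fun [set: mR * mR] (fun z => ((z.1 + s * z.2)%R, z.2) : mR * mR).
  apply: measurable_fun_pair => //.
  by apply: measurable_funD => //; apply: measurable_funM.
have mfs := measurableT_comp mf ms.
have -> := fubini_tonelli (m1 := mu) (m2 := mu) _ mfs (fun z => f0 _).
have -> := fubini_tonelli (m1 := mu) (m2 := mu) _ mf f0; apply: eq_integral => y _ /=.
have mfy : measurable_fun [set: mR] (fun x : mR => f (x, y)).
  by apply: measurableT_comp => //; exact: measurable_pair2.
exact: ge0_integral_shift mfy (fun x => f0 _).
Qed.

Lemma ge0_integral_shear2 (s : R) (f : mR * mR -> \bar R) :
  measurable_fun setT f -> (forall z, 0 <= f z) ->
  \int[mu]_x \int[mu]_y f (x, (y + s * x)%R) = \int[mu]_x \int[mu]_y f (x, y).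
Proof.
move=> mf f0; apply: eq_integral => x _ /=.
have mfx : measurable_fun [set: mR] (fun y : mR => f (x, y)).
  by apply: measurableT_comp => //; exact: measurable_pair1.
exact: ge0_integral_shift mfx (fun y => f0 _).
Qed.

(* A rotation by an angle other than pi is a product of three shears. *)
Lemma ge0_integral_rotation_proper (c s : R) (f : mR * mR -> \bar R) :
  measurable_fun setT f -> (forall z, 0 <= f z) ->
  (c ^+ 2 + s ^+ 2 = 1)%R -> (1 + c != 0)%R ->
  \int[mu]_x \int[mu]_y f ((c * x - s * y)%R, (s * x + c * y)%R) =
  \int[mu]_x \int[mu]_y f (x, y).
Proof.
(* For c = cos theta and s = sin theta this is t = - tan(theta / 2), and the rotation is the
   composition of the shears of parameters t, s, t. *)
move=> mf f0 cs c1; pose t : R := (- (s / (1 + c)))%R.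
have ms1 (a : R) : measurable_fun [set: mR * mR] (fun z => ((z.1 + a * z.2)%R, z.2) : mR * mR).
  apply: measurable_fun_pair => //.
  by apply: measurable_funD => //; apply: measurable_funM.
have ms2 (a : R) : measurable_fun [set: mR * mR] (fun z => (z.1, (z.2 + a * z.1)%R) : mR * mR).
  apply: measurable_fun_pair => //.
  by apply: measurable_funD => //; apply: measurable_funM.
refine (etrans _ (ge0_integral_shear1 t mf f0)).
have mf1 : measurable_fun setT (fun z : mR * mR => f ((z.1 + t * z.2)%R, z.2)).
  by apply: (measurableT_comp mf (ms1 t)).
refine (etrans _ (ge0_integral_shear2 s mf1 (fun z => f0 _))).
have mf2 : measurable_fun setT (fun z : mR * mR =>
   f ((z.1 + t * (z.2 + s * z.1))%R, (z.2 + s * z.1)%R)).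
  by apply: (measurableT_comp mf1 (ms2 s)).
refine (etrans _ (ge0_integral_shear1 t mf2 (fun z => f0 _))).
apply: eq_integral => x _; apply: eq_integral => y _ /=.
have s2 : (s ^+ 2 = (1 - c) * (1 + c))%R by rewrite -[LHS](addKr (c ^+ 2)%R) cs; ring.
have st : (s * t = c - 1)%R.
  by rewrite /t mulrN mulrA -expr2 s2 mulfK// opprB.
have tc : (t * (1 + c) = - s)%R by rewrite /t mulNr divfK.
congr (f (_, _)); last first.
  by rewrite -[in LHS](subrK 1%R c) -st; ring.
have -> : (x + t * y + t * (y + s * (x + t * y)) =
  x + s * t * x + t * y + (1 + s * t) * t * y)%R by ring.
rewrite st (_ : 1 + (c - 1) = c)%R; last by ring.
have -> : (x + (c - 1) * x + t * y + c * t * y = c * x + (t * (1 + c)) * y)%R by ring.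
by rewrite tc; ring.
Qed.

Lemma ge0_integral_rotation (c s : R) (f : mR * mR -> \bar R) :
  measurable_fun setT f -> (forall z, 0 <= f z) -> (c ^+ 2 + s ^+ 2 = 1)%R ->
  \int[mu]_x \int[mu]_y f ((c * x - s * y)%R, (s * x + c * y)%R) =
  \int[mu]_x \int[mu]_y f (x, y).
Proof.
move=> mf f0 cs.
(* The remaining angle pi is reached by two quarter turns. *)
have [c1|] := eqVneq (1 + c)%R 0%R; last exact: ge0_integral_rotation_proper.
have cE : c = (-1)%R by apply/eqP; rewrite -addr_eq0 addrC c1.
have sE : s = 0%R.
  by apply/eqP; rewrite -sqrf_eq0; apply/eqP; move: cs; rewrite cE; lra.
have mq : measurable_fun [set: mR * mR] (fun z => ((0 * z.1 - 1 * z.2)%R, (1 * z.1 + 0 * z.2)%R) : mR * mR).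
  by apply: measurable_fun_pair => //; [apply: measurable_funB|apply: measurable_funD];
    apply: measurable_funM.
have h01 : (0 ^+ 2 + 1 ^+ 2 = 1 :> R)%R by rewrite expr0n expr1n add0r.
have h10 : (1 + 0 != 0 :> R)%R by rewrite addr0 oner_neq0.
refine (etrans _ (ge0_integral_rotation_proper mf f0 h01 h10)).
refine (etrans _ (ge0_integral_rotation_proper (measurableT_comp mf mq) (fun z => f0 _) h01 h10)).
apply: eq_integral => x _; apply: eq_integral => y _ /=.
by rewrite cE sE; congr (f (_, _)); ring.
Qed.

(** The product density [p] depends on x^2 + y^2 only, so rotating [f] amounts to rotating [f * p],
    to which the invariance of Lebesgue measure applies. *)
Lemma normal_rotation (k c s : R) (f : mR * mR -> \bar R) : k != 0%R ->
  measurable_fun setT f -> (forall z, 0 <= f z) -> (c ^+ 2 + s ^+ 2 = 1)%R ->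
  \int[normal_prob 0 k]_x \int[normal_prob 0 k]_y
     f ((c * x - s * y)%R, (s * x + c * y)%R) =
  \int[normal_prob 0 k]_x \int[normal_prob 0 k]_y f (x, y).
Proof.
move=> k0 mf f0 cs.
have mq : measurable_fun [set: mR * mR] (fun z => ((c * z.1 - s * z.2)%R, (s * z.1 + c * z.2)%R) : mR * mR).
  by apply: measurable_fun_pair => //; [apply: measurable_funB|apply: measurable_funD];
    apply: measurable_funM.
pose p (z : mR * mR) : \bar R := (normal_pdf 0 k z.1 * normal_pdf 0 k z.2)%:E.
have mpdf : measurable_fun [set: mR] (fun x => (normal_pdf 0 k x)%:E).
  by apply/measurable_EFinP; exact: measurable_normal_pdf.
have mp : measurable_fun setT p.
  by apply/measurable_EFinP; apply: measurable_funM; apply: measurableT_comp => //;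
    exact: measurable_normal_pdf.
have p0 z : 0 <= p z by rewrite lee_fin mulr_ge0// normal_pdf_ge0.
have E (g : mR * mR -> \bar R) : measurable_fun setT g -> (forall z, 0 <= g z) ->
    \int[normal_prob 0 k]_x \int[normal_prob 0 k]_y g (x, y) =
    \int[mu]_x \int[mu]_y (g (x, y) * p (x, y)).
  move=> mg g0; rewrite ge0_integral_normal_prob//; first last.
  - by move=> x; exact: integral_ge0.
  - exact: (measurable_fun_fubini_tonelli_F g).
  apply: eq_integral => x _.
  rewrite ge0_integral_normal_prob//; last first.
    by apply: measurableT_comp => //; exact: measurable_pair1.
  rewrite muleC -ge0_integralZl//.
  - by apply: eq_integral => y _; rewrite /p/= EFinM muleCA !muleA.
  - apply: emeasurable_funM => //.
    by apply: measurableT_comp => //; exact: measurable_pair1.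
  - by move=> y _; rewrite mule_ge0// lee_fin normal_pdf_ge0.
  - by rewrite lee_fin normal_pdf_ge0.
have mfq := measurableT_comp mf mq.
rewrite [RHS](E _ mf f0).
have -> := E _ mfq (fun z => f0 _).
have mfp : measurable_fun [set: mR * mR] (fun z => f z * p z) by exact: emeasurable_funM.
have fp0 z : 0 <= f z * p z by rewrite mule_ge0.
refine (etrans _ (ge0_integral_rotation mfp fp0 cs)).
apply: eq_integral => x _; apply: eq_integral => y _ /=; congr (_ * _%:E).
rewrite /= !normal_pdfE// /normal_fun.
rewrite mulrACA -exp.expRD [RHS]mulrACA -exp.expRD; congr (_ * expR _)%R.
rewrite -!mulrDl; congr (_ / _)%R.
have -> : (- (x - 0) ^+ 2 + - (y - 0) ^+ 2 = - (1 * (x ^+ 2 + y ^+ 2)))%R by ring.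
by rewrite -cs; ring.
Qed.
End rotation.

(** * Probability of an orthant under two linear forms *)

(** Cauchy's functional equation on an interval: additivity and nonnegativity make [w] monotone, the
    value at pi / 2 determines it on the multiples of pi / (2 n), and any other point is squeezed
    between two neighbours of this grid. Additivity is available only for sums below pi, so every
    grid point used must stay below pi. *)
Lemma monotone_additive_linear (R : realType) (w : R -> R) :
  (forall a, 0 <= w a) ->
  (forall a b, 0 < a -> 0 < b -> a + b < pi -> w (a + b) = w a + w b) ->
  w (pi / 2) = 1 / 4 ->
  forall a, 0 < a -> a < pi -> w a = a / (2 * pi).
Proof.
move=> w0 wD wq a a0 api.
have fE (i p N : R) : 0 < p -> 0 < N -> i / (4 * N) = i * (p / 2 / N) / (2 * p).
  by move=> p0 N0; field; rewrite !lt0r_neq0.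
have pi0 : 0 < pi :> R := pi_gt0 R.
have wmono b c : 0 < b -> b <= c -> c < pi -> w b <= w c.
  move=> b0; rewrite le_eqVlt => /predU1P[->//|bc cpi].
  have -> : c = b + (c - b) by ring.
  by rewrite wD ?subr_gt0 ?lerDl// addrC subrK.
have wgrid (n j : nat) : (0 < n)%N -> (0 < j < n.*2)%N ->
    w (j%:R * (pi / 2 / n%:R)) = j%:R / (4 * n%:R).
  move=> n0; have nR : (0 : R) < n%:R by rewrite ltr0n.
  pose h : R := pi / 2 / n%:R.
  have h0 : 0 < h by rewrite !divr_gt0.
  have lin i : (0 < i < n.*2)%N -> w (i%:R * h) = i%:R * w h.
    elim: i => [//|[_ _|i IH /andP[_ i2]]]; first by rewrite !mul1r.
    have -> : i.+2%:R * h = i.+1%:R * h + h by rewrite -[in LHS](natr1 i.+1) mulrDl mul1r.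
    have ih0 : 0 < i.+1%:R * h by apply: mulr_gt0; rewrite ?ltr0n.
    rewrite (wD _ _ ih0 h0).
      rewrite IH; last by apply/andP; split=> //; exact: ltnW.
      by rewrite -[in RHS](natr1 i.+1) mulrDl mul1r.
    have -> : i.+1%:R * h + h = i.+2%:R * h by rewrite -[in RHS](natr1 i.+1) mulrDl mul1r.
    have -> : pi = n.*2%:R * h.
      by rewrite -muln2 natrM /h; field; rewrite lt0r_neq0.
    by rewrite ltr_pM2r// ltr_nat.
  move=> jn; rewrite -/h lin//.
  have : n%:R * w h = 1 / 4.
    rewrite -lin; last by rewrite n0 -addnn -[X in (X < _)%N]addn0 ltn_add2l.
    by rewrite -wq; congr w; rewrite /h mulrCA divff ?mulr1 ?lt0r_neq0.
  move=> nw; apply: (mulfI (lt0r_neq0 nR)).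
  by rewrite mulrCA nw; field; rewrite lt0r_neq0.
apply/eqP; rewrite -subr_eq0 -normr_eq0; apply/negPn/negP => e0.
have {}e0 : 0 < `|w a - a / (2 * pi)| by rewrite lt_def e0 normr_ge0.
set e := `|_| in e0.
(* Each of the first three summands is a demand on the number n of grid steps in [0, pi / 2]: an
   error below [e], a step shorter than [a], and two steps that fit between [a] and pi. *)
pose M : R := e^-1 + (pi / a) + (pi / (pi - a)) + 1.
have api' : 0 < pi - a by rewrite subr_gt0.
have M0 : 0 < M by rewrite !addr_gt0 ?divr_gt0 ?invr_gt0.
pose n := (Num.truncn M).+1.
have nM : M < n%:R by have /andP[] := truncn_itv (ltW M0).
have nR : (0 : R) < n%:R by rewrite ltr0n.
have ei : 0 < e^-1 by rewrite invr_gt0.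
have pa : 0 < pi / a by rewrite divr_gt0.
have pa' : 0 < pi / (pi - a) by rewrite divr_gt0.
have ME : M = e^-1 + (pi / a) + (pi / (pi - a)) + 1 by [].
have h1 : e^-1 < n%:R by lra.
have h2 : pi / a < n%:R by lra.
have h3 : pi / (pi - a) < n%:R by lra.
pose h : R := pi / 2 / n%:R.
have hE : n%:R * h = pi / 2 by rewrite /h mulrCA divff ?mulr1 ?lt0r_neq0.
have h0 : 0 < h by rewrite !divr_gt0.
pose j := Num.truncn (a / h).
have /andP[ja aj] := truncn_itv (ltW (divr_gt0 a0 h0)).
rewrite -/j ler_pdivlMr// in ja; rewrite -/j ltr_pdivrMr// in aj.
have ha : h < a.
  by move: h2; rewrite ltr_pdivrMr// => h2; rewrite -(ltr_pM2l nR) hE; lra.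
have hpa : 2 * h < pi - a.
  move: h3; rewrite ltr_pdivrMr// => h3.
  by rewrite -(ltr_pM2l nR) mulrCA hE; lra.
have j0 : (0 < j)%N.
  by rewrite lt0n; apply/eqP => j0; move: aj; rewrite j0 mul1r ltNge (ltW ha).
have jn : (j.+1 < n.*2)%N.
  rewrite -(ltr_nat R) -(ltr_pM2r h0) -muln2 natrM mulrAC hE divfK ?pnatr_eq0//.
  by rewrite -natr1 mulrDl mul1r; lra.
have wgridh i : (0 < i < n.*2)%N -> w (i%:R * h) = (i%:R * h) / (2 * pi).
  move=> iN; rewrite [LHS](wgrid n i (ltn0Sn _) iN).
  exact: fE.
have hp : h / (2 * pi) = (4 * n%:R)^-1 by rewrite -[h]mul1r -fE// mul1r.
clearbody j h; clear ME; clearbody n M.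
have wl : (j%:R * h) / (2 * pi) <= w a.
  rewrite -wgridh; last by rewrite j0 (ltn_trans (ltnSn j) jn).
  by apply: wmono ja api; apply: mulr_gt0 h0; rewrite ltr0n.
have jSh : j.+1%:R * h = j%:R * h + h by rewrite -natr1 mulrDl mul1r.
have wu : w a <= (j%:R * h + h) / (2 * pi).
  rewrite -jSh -wgridh; last by rewrite ltn0Sn jn.
  by apply: wmono a0 (ltW aj) _; rewrite jSh; lra.
have p2 : 0 < (2 * pi)^-1 :> R by rewrite invr_gt0 mulr_gt0.
have : e <= h / (2 * pi).
  rewrite /e ler_norml; apply/andP; split.
    rewrite -mulNr lerBrDr -mulrDl; apply: le_trans wl.
    by rewrite (ler_pM2r p2); lra.
  rewrite lerBlDr -mulrDl; apply: (le_trans wu).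
  by rewrite (ler_pM2r p2); lra.
rewrite hp leNgt => /negP; apply.
have : n%:R^-1 < e by rewrite -[e]invrK ltf_pV2 ?posrE ?invr_gt0.
apply: le_lt_trans; rewrite lef_pV2 ?posrE ?mulr_gt0//.
by rewrite ler_peMl ?ler1n ?ltW// ler1n.
Qed.

Lemma measurable_lt0 (R : realType) : measurable [set x : measurableTypeR R | x < 0].
Proof.
by rewrite (_ : [set x | _] = `]-oo, 0[%classic)//; apply/seteqP; split => x /=; rewrite in_itv.
Qed.

Lemma measurable_gt0 (R : realType) : measurable [set x : measurableTypeR R | 0 < x].
Proof.
by rewrite (_ : [set x | _] = `]0, +oo[%classic)//; apply/seteqP; split => x /=; rewrite in_itv/= andbT.
Qed.

Lemma measurable_ge0 (R : realType) : measurable [set x : measurableTypeR R | 0 <= x].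
Proof.
by rewrite (_ : [set x | _] = `[0, +oo[%classic)//; apply/seteqP; split => x /=; rewrite in_itv/= andbT.
Qed.

Lemma normal_prob_set1 (R : realType) (k a : R) : normal_prob 0 k [set a] = 0%E.
Proof. by rewrite /normal_prob integral_set1. Qed.

Section wedge.
Variables (R : realType) (k : R).
Hypothesis k0 : k != 0.
Local Notation mR := (measurableTypeR R).
Local Notation N := (normal_prob 0 k).
Local Notation N2 := (N \x N)%E.

Lemma product_normalE (f : mR * mR -> \bar R) : measurable_fun setT f -> (forall z, 0 <= f z)%E ->
  (\int[N2]_z f z = \int[N]_x \int[N]_y f (x, y))%E.
Proof. by move=> mf f0; rewrite fubini_tonelli1. Qed.

Lemma product_normal_rotation (c s : R) (A : set (mR * mR)) :
  measurable A -> c ^+ 2 + s ^+ 2 = 1 ->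
  N2 [set z | A (c * z.1 - s * z.2, s * z.1 + c * z.2)] = N2 A.
Proof.
move=> mA cs.
have mq : measurable_fun [set: mR * mR] (fun z => ((c * z.1 - s * z.2)%R, (s * z.1 + c * z.2)%R) : mR * mR).
  by apply: measurable_fun_pair => //; [apply: measurable_funB|apply: measurable_funD];
    apply: measurable_funM.
have mB : measurable [set z : mR * mR | A (c * z.1 - s * z.2, s * z.1 + c * z.2)].
  by have := mq measurableT _ mA; rewrite setTI.
have mind (B : set (mR * mR)) : measurable B ->
    measurable_fun setT (fun z => (\1_B z : R)%:E).
  by move=> mB'; apply/measurable_EFinP; exact: measurable_indic.
have iE (B : set (mR * mR)) : measurable B ->
    N2 B = (\int[N]_x \int[N]_y (\1_B (x, y))%:E)%E.
  move=> mB'; rewrite -(product_normalE (mind _ mB')); last by move=> z; rewrite lee_fin.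
  have := @integral_indic _ _ _ N2 _ measurableT _ mB'.
  by rewrite setIT => ->.
rewrite (iE _ mB) (iE _ mA).
refine (etrans _ (normal_rotation k0 (mind _ mA) _ cs)); last by move=> z; rewrite lee_fin.
by apply: eq_integral => x _; apply: eq_integral => y _; rewrite !indicE.
Qed.

Lemma product_normalX (A B : set mR) : measurable A -> measurable B ->
  N2 (A `*` B) = (N A * N B)%E.
Proof. exact: product_measure1E. Qed.

Lemma normal_probT : N setT = 1%E.
Proof. exact: probability_setT. Qed.

Lemma product_normalT : N2 setT = 1%E.
Proof.
by rewrite -setXTT product_normalX// normal_probT mule1.
Qed.

Definition lin2 (p q : R) (z : mR * mR) : R := p * z.1 + q * z.2.

Lemma measurable_lin2 p q : measurable_fun setT (lin2 p q).
Proof. by apply: measurable_funD; apply: measurable_funM. Qed.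

Lemma measurable_lin2_ge0 p q : measurable [set z | 0 <= lin2 p q z].
Proof.
rewrite (_ : [set z | _] = lin2 p q @^-1` `[0, +oo[); last first.
  by apply/seteqP; split => z /=; rewrite in_itv/= andbT.
by rewrite -[X in measurable X]setTI; apply: measurable_lin2.
Qed.

Lemma measurable_lin2_lt0 p q : measurable [set z | lin2 p q z < 0].
Proof.
rewrite (_ : [set z | _] = ~` [set z | 0 <= lin2 p q z]); last first.
  by apply/seteqP; split => z /=; rewrite ltNge => /negP.
by apply: measurableC; exact: measurable_lin2_ge0.
Qed.

Definition ray (a : R) := lin2 (cos a) (sin a).
(** For 0 < b - a < pi this is the cone of directions in [a - pi / 2, b - pi / 2), of opening b - a.
    One closed and one open side make adjacent wedges disjoint without a gap. *)
Definition wedge (a b : R) := [set z | 0 <= ray a z] `&` [set z | ray b z < 0].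

Lemma measurable_wedge a b : measurable (wedge a b).
Proof. by apply: measurableI; [exact: measurable_lin2_ge0|exact: measurable_lin2_lt0]. Qed.

Lemma product_normal_wedgeD a b : N2 (wedge a (a + b)) = N2 (wedge 0 b).
Proof.
rewrite -(@product_normal_rotation (cos a) (- sin a) (wedge 0 b)); last 2 first.
- exact: measurable_wedge.
- by rewrite sqrrN cos2Dsin2.
congr (N2 _); apply/seteqP; rewrite /wedge /ray /lin2 trigo.cosD trigo.sinD cos0 sin0.
by split=> z /= [h1 h2]; split; nra.
Qed.

Definition wedge_measure (a : R) : R := fine (N2 (wedge 0 a)).

Lemma product_normal_fin (A : set (mR * mR)) : measurable A -> N2 A \is a fin_num.
Proof.
move=> mA; rewrite ge0_fin_numE ?measure_ge0//.
apply: (@le_lt_trans _ _ (N2 setT)); first by apply: le_measure; rewrite ?inE.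
by rewrite product_normalT ltry.
Qed.

Lemma wedge_measureD a b : 0 < a -> 0 < b -> a + b < pi ->
  wedge_measure (a + b) = wedge_measure a + wedge_measure b.
Proof.
move=> a0 b0 abpi.
have sa : 0 < sin a by apply: sin_gt0_pi; apply/andP; split => //; lra.
have sb : 0 < sin b by apply: sin_gt0_pi; apply/andP; split => //; lra.
have sab : 0 < sin (a + b) by apply: sin_gt0_pi; apply/andP; split => //; lra.
(* The direction a lies between 0 and a + b, so [ray a] is a combination of the outer two with
   positive coefficients; this supplies the missing sign on each of the two pieces. *)
have key z : sin b * ray 0 z + sin a * ray (a + b) z = sin (a + b) * ray a z.
  have := cos2Dsin2 a; rewrite /ray /lin2 cos0 sin0 trigo.cosD trigo.sinD => ca.
  have -> : sin b * (1 * z.1 + 0 * z.2) = sin b * ((cos a ^+ 2 + sin a ^+ 2) * z.1) by rewrite ca; ring.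
  by ring.
rewrite /wedge_measure -[X in _ = _ + fine X](product_normal_wedgeD a b).
rewrite -fineD ?product_normal_fin//; [|exact: measurable_wedge..].
have disj : wedge 0 a `&` wedge a (a + b) = set0.
  apply/seteqP; split => z //=; rewrite /wedge/= => -[[_ h1] [h2 _]].
  by move: h1; rewrite ltNge h2.
have union : wedge 0 (a + b) = wedge 0 a `|` wedge a (a + b).
  apply/seteqP; split => z; rewrite /wedge /=; have := key z.
    move=> kz [z1 z2]; have [h|h] := ltP (ray a z) 0; [by left|by right].
  move=> kz [[z1 z2]|[z1 z2]]; split => //; nra.
by rewrite union; congr fine; exact: measureU (measurable_wedge _ _) (measurable_wedge _ _) disj.
Qed.

(** The half-turn of the plane sends one strip [A x R] to the other, so planar invariance contains
    the symmetry of the line. *)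
Lemma normal_prob_lt0 : N [set x : mR | x < 0] = N [set x : mR | 0 < x].
Proof.
have mA := @measurable_lt0 R; have mB := @measurable_gt0 R.
have E (A : set mR) : measurable A -> N A = N2 (A `*` setT).
  by move=> m; rewrite product_normalX// normal_probT mule1.
rewrite (E _ mA) (E _ mB).
have mBT : measurable ([set x : mR | 0 < x] `*` [set: mR]) by exact: measurableX.
have h10 : (-1) ^+ 2 + 0 ^+ 2 = 1 :> R by rewrite sqrrN expr1n expr0n addr0.
refine (etrans _ (product_normal_rotation mBT h10)); congr (N2 _).
by apply/seteqP; split => -[x y] /= [h _]; split => //; move: h; lra.
Qed.

Lemma normal_prob_half : N [set x : mR | x < 0] = (1 / 2)%:E /\
  N [set x : mR | 0 <= x] = (1 / 2)%:E.
Proof.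
have mA := @measurable_lt0 R; have mB := @measurable_gt0 R.
have B0 : [set x : mR | 0 <= x] = [set x : mR | 0 < x] `|` [set 0].
  apply/seteqP; split => x /=; rewrite le_eqVlt.
    by move=> /predU1P[->|]; [right|left].
  by move=> [->|->]; rewrite ?eqxx ?orbT.
have NB : N [set x : mR | 0 <= x] = N [set x : mR | 0 < x].
  rewrite B0 measureU//.
    by rewrite -[RHS]adde0; congr (_ + _)%E; exact: normal_prob_set1.
  by apply/seteqP; split => x //= [+ h]; rewrite h ltxx.
have : (N [set x : mR | (x < 0)%R] + N [set x : mR | (0 <= x)%R] = 1)%E.
  rewrite -[RHS]normal_probT -measureU//.
  - congr (N _); apply/seteqP; split => x //= _.
    by have [h|h] := ltP x 0; [left|right].
  - by rewrite B0; apply: measurableU.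
  - by apply/seteqP; split => x //= [h1 h2]; move: h1; rewrite ltNge h2.
have f1 : N [set x : mR | 0 < x] \is a fin_num by exact: fin_num_measure.
rewrite NB normal_prob_lt0; move: f1; case: (N _) => // r _.
by rewrite -EFinD => /eqP; rewrite eqe => /eqP h; split; congr (_%:E); lra.
Qed.

Lemma wedge_measure_pihalf : wedge_measure (pi / 2) = 1 / 4.
Proof.
have [h1 h2] := normal_prob_half.
rewrite /wedge_measure (_ : wedge _ _ = [set x : mR | 0 <= x] `*` [set x : mR | x < 0]); last first.
  apply/seteqP; rewrite /wedge /ray /lin2 cos0 sin0 cos_pihalf sin_pihalf.
  by split => -[x y] /= [z1 z2]; split; lra.
rewrite product_normalX//.
- by rewrite h1 h2 -EFinM/=; lra.
- exact: measurable_ge0.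
- exact: measurable_lt0.
Qed.

Lemma wedge_measureE a : 0 < a -> a < pi -> wedge_measure a = a / (2 * pi).
Proof.
apply: monotone_additive_linear.
- by move=> b; rewrite fine_ge0.
- exact: wedge_measureD.
- exact: wedge_measure_pihalf.
Qed.

(** With p = cos theta and q = sin theta, the half-plane 0 <= z.1 is the disjoint union of this set
    and of a wedge of opening theta, whence 1 / 2 - theta / (2 pi). *)
Lemma orthant_probability p q : p ^+ 2 + q ^+ 2 = 1 -> 0 <= q ->
  N2 [set z : mR * mR | 0 <= z.1 /\ 0 <= p * z.1 + q * z.2] =
  ((pi - acos p) / (2 * pi))%:E.
Proof.
move=> pq q0; have pi0 : 0 < pi :> R := pi_gt0 R.
have [h1 h2] := normal_prob_half.
have mpos := @measurable_ge0 R.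
have mH p' q' : measurable [set z : mR * mR | 0 <= p' * z.1 + q' * z.2] := measurable_lin2_ge0 p' q'.
have pos_half : N2 ([set x : mR | 0 <= x] `*` setT) = (1 / 2)%:E.
  by rewrite product_normalX// normal_probT mule1.
(* At p = 1 and p = -1 the angle is an end of [0, pi], where [wedge_measureE] says nothing; there
   the set is a half-plane or a line. *)
have [p1|p1] := eqVneq p 1.
  have q00 : q = 0 by apply/eqP; rewrite -sqrf_eq0; apply/eqP; move: pq; rewrite p1; lra.
  rewrite p1 q00 acos1 subr0 (_ : [set z | _] = [set x : mR | 0 <= x] `*` setT).
    rewrite pos_half; congr (_%:E).
    by rewrite invfM mulrCA divff ?mulr1 ?mul1r// lt0r_neq0.
  by apply/seteqP; split => -[x y] /= [z1 z2]; split => //; lra.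
have [pN1|pN1] := eqVneq p (-1).
  have q00 : q = 0 by apply/eqP; rewrite -sqrf_eq0; apply/eqP; move: pq; rewrite pN1; lra.
  rewrite pN1 q00 acosN1 subrr mul0r (_ : [set z | _] = [set 0] `*` setT).
    rewrite product_normalX// normal_probT mule1; exact: normal_prob_set1.
  by apply/seteqP; split => -[x y] /= [z1 z2]; split => //; lra.
have p2 : p ^+ 2 <= 1 by rewrite -pq lerDl sqr_ge0.
have pitv : -1 < p < 1.
  apply/andP; split; rewrite lt_neqAle.
    by rewrite eq_sym pN1/=; nra.
  by rewrite p1/=; nra.
have /andP[pl pr] := pitv.
have a0 : 0 < acos p by apply: acos_gt0; rewrite (ltW pl) pr.
have api : acos p < pi by apply: acos_ltpi; rewrite (ltW pr) pl.
have ca : cos (acos p) = p by apply: acosK; rewrite in_itv/= !ltW.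
have sa : sin (acos p) = q.
  rewrite sin_acos ?ltW// -[RHS]ger0_norm// -sqrtr_sqr; congr Num.sqrt.
  by rewrite -pq; ring.
have wE : N2 (wedge 0 (acos p)) = (acos p / (2 * pi))%:E.
  by rewrite -wedge_measureE// /wedge_measure fineK// product_normal_fin//; exact: measurable_wedge.
have mO : measurable [set z : mR * mR | (0 <= z.1)%R /\ (0 <= p * z.1 + q * z.2)%R].
  rewrite (_ : [set z | _] = ([set x : mR | 0 <= x] `*` setT) `&` [set z | 0 <= p * z.1 + q * z.2]).
    by apply: measurableI => //; exact: measurableX.
  by apply/seteqP; split => -[x y] /=; tauto.
have disj : [set z : mR * mR | (0 <= z.1)%R /\ (0 <= p * z.1 + q * z.2)%R] `&` wedge 0 (acos p) = set0.
  apply/seteqP; rewrite /wedge /ray /lin2 ca sa.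
  by split => -[x y] //= [[_ h1'] [_ h2']]; lra.
have : (N2 [set z : mR * mR | (0 <= z.1)%R /\ (0 <= p * z.1 + q * z.2)%R] + N2 (wedge 0 (acos p)) = (1 / 2)%:E)%E.
  rewrite -pos_half.
  refine (etrans (esym (measureU _ mO (measurable_wedge _ _) disj)) _).
  congr (N2 _); apply/seteqP; rewrite /wedge /ray /lin2 cos0 sin0 ca sa.
  split => -[x y] /=.
    by move=> [[z1 z2]|[z1 z2]]; split => //; lra.
  move=> [z1 _]; have [h|h] := ltP (p * x + q * y) 0; last by left.
  by right; split => //; lra.
rewrite wE; case: (N2 _) => // r; rewrite -EFinD => /eqP; rewrite eqe => /eqP h.
congr (_%:E); have -> : (pi - acos p) / (2 * pi) = 1 / 2 - acos p / (2 * pi).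
  rewrite mulrBl; congr (_ - _).
  by rewrite invfM mulrCA divff ?mulr1 ?mul1r// lt0r_neq0.
by lra.
Qed.

End wedge.

(** * Independence of functions of disjoint families *)

Section independence.
Context (dT : measure_display) (T : measurableType dT) (P : probability T RR).
Context (J : finType) (X : J -> T -> RR).
Local Notation mR := (measurableTypeR RR).
Hypothesis mX : forall i, measurable_fun setT (X i : T -> mR).
Hypothesis indX : mutually_independent P X.

(** A pi-system generating the sigma-algebra of the coordinates in [D]. The intersection runs over
    all of [J], with [setT] outside [D], which is the format of [mutually_independent]. *)
Definition cylinders (D : {set J}) : set (set T) :=
  [set A | exists B : J -> set mR, [/\ forall i, measurable (B i),
     forall i, i \notin D -> B i = setT &
     A = \bigcap_(i in [set: J]) (X i @^-1` B i)]].

Lemma measurable_preimageX i (B : set mR) : measurable B -> measurable (X i @^-1` B).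
Proof. by move=> mB; rewrite -[X in measurable X]setTI; exact: mX. Qed.

Lemma cylinders_measurable D : cylinders D `<=` measurable.
Proof.
move=> _ [B [mB _ ->]]; apply: fin_bigcap_measurable => [|i _].
  exact: finite_finset.
exact: measurable_preimageX.
Qed.

Lemma cylindersT D : cylinders D setT.
Proof.
exists (fun _ => setT); split => //.
by apply/seteqP; split.
Qed.

Lemma cylinders_setI D : setI_closed (cylinders D).
Proof.
move=> A A' [B [mB BD ->]] [B' [mB' BD' ->]].
exists (fun i => B i `&` B' i); split.
- by move=> i; exact: measurableI.
- by move=> i iD; rewrite BD// BD'// setTI.
- apply/seteqP; split => [t [h h'] i _|t h].
    by split; [exact: h|exact: h'].
  by split => i _; have [] := h i I.
Qed.

Lemma cylinders_indep (D D' : {set J}) A A' : (forall i, i \in D -> i \notin D') ->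
  cylinders D A -> cylinders D' A' -> P (A `&` A') = (P A * P A')%E.
Proof.
move=> DD' [B [mB BD ->]] [B' [mB' BD' ->]].
have -> : \bigcap_(i in [set: J]) (X i @^-1` B i) `&` \bigcap_(i in [set: J]) (X i @^-1` B' i) =
   \bigcap_(i in [set: J]) (X i @^-1` (B i `&` B' i)).
  apply/seteqP; split => [t [h h'] i _|t h].
    by split; [exact: h|exact: h'].
  by split => i _; have [] := h i I.
rewrite !indX//; last by move=> i; exact: measurableI.
rewrite -big_split/=; apply: eq_bigr => i _.
(* At each coordinate one of the two constraints is [setT], so the probability of the intersection
   factors there. *)
have [iD|iD] := boolP (i \in D).
  rewrite (BD' i); last exact: DD'.
  by rewrite setIT preimage_setT probability_setT mule1.
by rewrite (BD i)// setTI preimage_setT probability_setT mul1e.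
Qed.

Lemma sigma_cylinders_measurable D A : <<s cylinders D >> A -> measurable A.
Proof. by move: A; apply: smallest_sub; [exact: sigma_algebra_measurable|exact: cylinders_measurable]. Qed.

(** As functions of A, both sides are finite measures: P restricted to A', and P scaled by P(A').
    They agree on the pi-system [C], hence on the sigma-algebra it generates. *)
Lemma indep_extend (C : set (set T)) (A' : set T) :
  C `<=` measurable -> C setT -> setI_closed C -> measurable A' ->
  (forall A, C A -> P (A `&` A') = (P A * P A')%E) ->
  forall A, <<s C >> A -> P (A `&` A') = (P A * P A')%E.
Proof.
move=> Cm CT CI mA' CA A sA.
have fA' : P A' \is a fin_num by exact: fin_num_measure.
have p0 : 0 <= fine (P A') by rewrite fine_ge0.
pose m1 : {measure set T -> \bar RR} := mrestr P mA'.
pose m2 : {measure set T -> \bar RR} := mscale (NngNum p0) P.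
have E : m1 A = m2 A.
  apply: (@g_sigma_algebra_measure_unique _ _ _ C Cm (fun _ => setT) _ _ m1 m2) => //.
  - by rewrite bigcup_const.
  - by move=> B CB; rewrite /m1 /m2/= /mrestr /mscale/= fineK// CA// muleC.
  - by move=> _; rewrite /m1/= /mrestr setTI; apply: (le_lt_trans (probability_le1 _ mA')); rewrite ltry.
by move: E; rewrite /m1 /m2/= /mrestr /mscale/= fineK// muleC.
Qed.

Lemma sigma_cylinders_indep (D D' : {set J}) A A' : (forall i, i \in D -> i \notin D') ->
  <<s cylinders D >> A -> <<s cylinders D' >> A' -> P (A `&` A') = (P A * P A')%E.
Proof.
move=> DD' sA sA'.
apply: (@indep_extend (cylinders D)) sA.
- exact: cylinders_measurable.
- exact: cylindersT.
- exact: cylinders_setI.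
- exact: sigma_cylinders_measurable sA'.
- move=> B CB; rewrite setIC muleC.
  apply: (@indep_extend (cylinders D')) sA'.
  + exact: cylinders_measurable.
  + exact: cylindersT.
  + exact: cylinders_setI.
  + exact: cylinders_measurable CB.
  + by move=> B' CB'; rewrite setIC muleC; exact: cylinders_indep CB CB'.
Qed.

(** The sample space with the smaller sigma-algebra of the coordinates in [D]: a map measurable from
    this type is one that depends on these coordinates alone, so the ordinary measurability lemmas
    can prove such dependence. *)
Definition cylinderType (D : {set J}) := g_sigma_algebraType (cylinders D).

Lemma measurable_coordinate (D : {set J}) i : i \in D ->
  measurable_fun [set: cylinderType D] (X i : cylinderType D -> mR).
Proof.
move=> iD _ B mB; rewrite setTI; apply: sub_sigma_algebra.
exists (fun j => if j == i then B else setT); split.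
- by move=> j; case: ifP.
- by move=> j jD; case: eqP => // ji; rewrite ji iD in jD.
- apply/seteqP; split => [t Bt j _|t /(_ i I)] /=.
    by case: eqP => [->|].
  by rewrite eqxx.
Qed.

Lemma indep_preimage (D D' : {set J}) d1 d2 (U1 : measurableType d1) (U2 : measurableType d2)
    (f1 : T -> U1) (f2 : T -> U2) A1 A2 : (forall i, i \in D -> i \notin D') ->
  measurable_fun [set: cylinderType D] (f1 : cylinderType D -> U1) ->
  measurable_fun [set: cylinderType D'] (f2 : cylinderType D' -> U2) ->
  measurable A1 -> measurable A2 ->
  P (f1 @^-1` A1 `&` f2 @^-1` A2) = (P (f1 @^-1` A1) * P (f2 @^-1` A2))%E.
Proof.
move=> DD' mf1 mf2 mA1 mA2; apply: (sigma_cylinders_indep DD').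
- by have := mf1 measurableT _ mA1; rewrite setTI.
- by have := mf2 measurableT _ mA2; rewrite setTI.
Qed.

Lemma measurable_cylinder_fun (D : {set J}) d1 (U1 : measurableType d1) (f1 : T -> U1) :
  measurable_fun [set: cylinderType D] (f1 : cylinderType D -> U1) ->
  measurable_fun setT f1.
Proof.
move=> mf1 _ A mA; rewrite setTI.
have := mf1 measurableT _ mA; rewrite setTI; exact: sigma_cylinders_measurable.
Qed.

End independence.

(** The joint law is the product of the marginals because both agree on rectangles; Tonelli then
    integrates [f2] out. The law of [f1] stays implicit, as an integral over [P], so that
    coordinates can be absorbed one by one. *)
Lemma indep_integral (R : realType) dT (T : measurableType dT) (P : probability T R)
    d1 d2 (U1 : measurableType d1) (U2 : measurableType d2)
    (f1 : T -> U1) (f2 : T -> U2) (N : probability U2 R) (F : U1 * U2 -> \bar R) :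
  measurable_fun setT f1 -> measurable_fun setT f2 ->
  (forall A, measurable A -> P (f2 @^-1` A) = N A) ->
  (forall A1 A2, measurable A1 -> measurable A2 ->
    P (f1 @^-1` A1 `&` f2 @^-1` A2) = (P (f1 @^-1` A1) * P (f2 @^-1` A2))%E) ->
  measurable_fun setT F -> (forall z, 0 <= F z)%E ->
  (\int[P]_t F (f1 t, f2 t) = \int[P]_t \int[N]_y F (f1 t, y))%E.
Proof.
move=> mf1 mf2 f2N ind mF F0.
have mf12 : measurable_fun setT (fun t => (f1 t, f2 t)) by exact: measurable_fun_pair.
pose g1 : {mfun T >-> U1} := HB.pack f1 (isMeasurableFun.Build _ _ _ _ _ mf1).
pose g12 : {mfun T >-> (U1 * U2)%type} := HB.pack (fun t => (f1 t, f2 t)) (isMeasurableFun.Build _ _ _ _ _ mf12).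
pose M1 : probability U1 R := distribution P g1.
pose M12 : probability (U1 * U2)%type R := distribution P g12.
have M12E A : measurable A -> (M1 \x N)%E A = M12 A.
  apply: product_measure_unique => A1 A2 mA1 mA2.
  rewrite /M12 /M1 /distribution/= /pushforward -f2N// -ind//.
transitivity (\int[M12]_z F z)%E.
  by rewrite [RHS](ge0_integral_pushforward mf12).
transitivity (\int[M1 \x N]_z F z)%E.
  by apply: eq_measure_integral => A mA _; exact/esym/M12E.
rewrite (fubini_tonelli1 _ mF F0).
rewrite (ge0_integral_pushforward mf1)//.
  exact: (measurable_fun_fubini_tonelli_F F).
by move=> x _; exact: integral_ge0.
Qed.

(** * Joint law of two projections of a Gaussian vector *)

Ltac solve_measurable := repeat first
  [ exact: measurable_cst | exact: measurable_id | exact: measurable_fst | exact: measurable_snd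
  | apply: measurable_fun_pair | apply: measurable_funD | apply: measurable_funB | apply: measurable_funM
  | (apply: measurableT_comp; [exact: measurable_fst|])
  | (apply: measurableT_comp; [exact: measurable_snd|]) | done ].

Section gaussian_pair.
Variables (R : realType) (k : R).
Hypothesis k0 : k != 0.
Local Notation mR := (measurableTypeR R).
Local Notation N := (normal_prob 0 k).
Local Open Scope ereal_scope.

Lemma exists_polar (a b : R) : exists r c s : R,
  [/\ (0 <= r)%R, (c ^+ 2 + s ^+ 2 = 1)%R, a = (r * c)%R, b = (r * s)%R & (r ^+ 2 = a ^+ 2 + b ^+ 2)%R].
Proof.
pose r := Num.sqrt (a ^+ 2 + b ^+ 2).
have ab0 : (0 <= a ^+ 2 + b ^+ 2)%R by rewrite addr_ge0 ?sqr_ge0.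
have r2 : (r ^+ 2 = a ^+ 2 + b ^+ 2)%R by rewrite sqr_sqrtr.
have [r0|r0] := eqVneq r 0%R.
  have /andP[/eqP a0 /eqP b0] : (a == 0%R) && (b == 0%R).
    by move: r2; rewrite r0 expr0n/= => /esym/eqP; rewrite paddr_eq0 ?sqr_ge0// !sqrf_eq0.
  exists 0%R, 1%R, 0%R; rewrite a0 b0; split => //; ring.
exists r, (a / r)%R, (b / r)%R; split => //; first exact: sqrtr_ge0.
- by rewrite !expr_div_n -mulrDl -r2 divff// sqrf_eq0.
- by rewrite mulrCA divff// mulr1.
- by rewrite mulrCA divff// mulr1.
Qed.

Lemma normal_rotation_inv (c s : R) (f : mR * mR -> \bar R) :
  measurable_fun setT f -> (forall z, 0 <= f z) -> (c ^+ 2 + s ^+ 2 = 1)%R ->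
  \int[N]_x \int[N]_y f ((c * x + s * y)%R, (- s * x + c * y)%R) =
  \int[N]_x \int[N]_y f (x, y).
Proof.
move=> mf f0 cs.
have cs' : (c ^+ 2 + (- s) ^+ 2 = 1)%R by rewrite sqrrN.
refine (etrans _ (normal_rotation k0 mf f0 cs')).
apply: eq_integral => x _; apply: eq_integral => y _.
by congr (f (_, _)); ring.
Qed.

Lemma normal_swap (f : mR * mR -> \bar R) :
  measurable_fun setT f -> (forall z, 0 <= f z) ->
  \int[N]_x \int[N]_y f (x, y) = \int[N]_y \int[N]_x f (x, y).
Proof. by move=> mf f0; exact: (fubini_tonelli (m1 := N) (m2 := N) f mf f0). Qed.

Lemma normal_integral_cst (a : \bar R) : 0 <= a -> \int[N]_x a = a.
Proof. by move=> a0; rewrite integral_cst// [X in a * X]probability_setT mule1. Qed.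

Lemma measurable_inner_normal (f : (mR * mR) * mR -> \bar R) :
  measurable_fun setT f -> (forall z, 0 <= f z) ->
  measurable_fun setT (fun z : mR * mR => \int[N]_y f (z, y)).
Proof.
by move=> mf f0; exact: (measurable_fun_fubini_tonelli_F (m2 := N) f mf f0).
Qed.

(* Absorbs one more independent coordinate g3 into a pair of forms in triangular
   shape: a rotation of (g1, g3) clears g3 from the first form, then a rotation of
   g2 and the new third variable clears the latter from the second form. *)
Lemma normal_pair_fold (al be ga x x' : R) : exists al' be' ga' : R,
  [/\ (0 <= al')%R /\ (0 <= ga')%R, (al' ^+ 2 = al ^+ 2 + x ^+ 2)%R, (al' * be' = al * be + x * x')%R,
      (be' ^+ 2 + ga' ^+ 2 = be ^+ 2 + ga ^+ 2 + x' ^+ 2)%R &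
   forall f : mR * mR -> \bar R, measurable_fun setT f -> (forall z, 0 <= f z) ->
   \int[N]_g1 \int[N]_g2 \int[N]_g3
      f ((al * g1 + x * g3)%R, (be * g1 + ga * g2 + x' * g3)%R) =
   \int[N]_g1 \int[N]_g2 f ((al' * g1)%R, (be' * g1 + ga' * g2)%R)].
Proof.
have [r [c [s [r_ge0 cs alE xE r2]]]] := exists_polar al x.
(* In the coordinates p, q obtained by rotating (g1, g3), the two forms read r p and b' p + ta q +
   ga g2. *)
pose b' : R := (be * c + x' * s)%R; pose ta : R := (- be * s + x' * c)%R.
have [r' [c' [s' [r'_ge0 cs' gaE taE r'2]]]] := exists_polar ga ta.
have bt : (b' ^+ 2 + ta ^+ 2 = be ^+ 2 + x' ^+ 2)%R.
  have -> : (be ^+ 2 + x' ^+ 2 = (c ^+ 2 + s ^+ 2) * (be ^+ 2 + x' ^+ 2))%R by rewrite cs mul1r.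
  by rewrite /b' /ta; ring.
exists r, b', r'; split; [by []|exact: r2| | |].
- by rewrite /b' alE xE; ring.
- by rewrite r'2 addrCA bt; ring.
move=> f mf f0.
have meas (g : (mR * mR) * mR -> mR * mR) : measurable_fun setT g ->
    measurable_fun setT (fun z => f (g z)).
  by move=> mg; exact: (measurableT_comp mf mg).
have meas2 (g : mR * mR -> mR * mR) : measurable_fun setT g ->
    measurable_fun setT (fun z => f (g z)).
  by move=> mg; exact: (measurableT_comp mf mg).
have mF1 : measurable_fun setT (fun z : mR * mR => \int[N]_g3
      f ((al * z.1 + x * g3)%R, (be * z.1 + ga * z.2 + x' * g3)%R)).
  apply: (measurable_inner_normal (f := fun w : (mR * mR) * mR =>
    f ((al * w.1.1 + x * w.2)%R, (be * w.1.1 + ga * w.1.2 + x' * w.2)%R))) => //.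
  by apply: meas; solve_measurable.
have F10 z : 0 <= \int[N]_g3 f ((al * z.1 + x * g3)%R, (be * z.1 + ga * z.2 + x' * g3)%R).
  exact: integral_ge0.
(* Moving g2 outside leaves g1 and g3 as the two inner variables, as the planar rotation requires;
   the second swap below does the same for g2 and q. *)
refine (etrans (normal_swap mF1 F10) _) => /=.
transitivity (\int[N]_g2 \int[N]_p \int[N]_q f ((r * p)%R, (b' * p + ta * q + ga * g2)%R)).
  apply: eq_integral => g2 _.
  have mPhi : measurable_fun setT (fun z : mR * mR => f ((r * z.1)%R, (b' * z.1 + ta * z.2 + ga * g2)%R)).
    by apply: meas2; solve_measurable.
  refine (etrans _ (normal_rotation_inv mPhi (fun z => f0 _) cs)).
  apply: eq_integral => g1 _; apply: eq_integral => g3 _ /=.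
  congr (f (_, _)); first by rewrite alE xE; ring.
  have -> : (be * g1 + ga * g2 + x' * g3 = (c ^+ 2 + s ^+ 2) * (be * g1 + x' * g3) + ga * g2)%R.
    by rewrite cs; ring.
  by rewrite /b' /ta; ring.
have mF2 : measurable_fun setT (fun z : mR * mR => \int[N]_q
      f ((r * z.2)%R, (b' * z.2 + ta * q + ga * z.1)%R)).
  apply: (measurable_inner_normal (f := fun w : (mR * mR) * mR =>
    f ((r * w.1.2)%R, (b' * w.1.2 + ta * w.2 + ga * w.1.1)%R))) => //.
  by apply: meas; solve_measurable.
have F20 z : 0 <= \int[N]_q f ((r * z.2)%R, (b' * z.2 + ta * q + ga * z.1)%R).
  exact: integral_ge0.
refine (etrans (normal_swap mF2 F20) _) => /=.
apply: eq_integral => p _.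
have mPsi : measurable_fun setT (fun z : mR * mR => f ((r * p)%R, (b' * p + r' * z.1)%R)).
  by apply: meas2; solve_measurable.
transitivity (\int[N]_u \int[N]_v f ((r * p)%R, (b' * p + r' * u)%R)).
  refine (etrans _ (normal_rotation_inv mPsi (fun z => f0 _) cs')).
  apply: eq_integral => g2 _; apply: eq_integral => q _ /=.
  by congr (f (_, _)); rewrite gaE taE; ring.
by apply: eq_integral => u _; rewrite normal_integral_cst.
Qed.

End gaussian_pair.

Section gaussian_projection.
Context (dT : measure_display) (T : measurableType dT) (P : probability T RR).
Context (J : finType) (X : J -> T -> RR) (k : RR).
Local Notation mR := (measurableTypeR RR).
Local Notation N := (normal_prob 0 k).
Hypothesis k0 : k != 0.
Hypothesis mX : forall i, measurable_fun setT (X i : T -> mR).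
Hypothesis indX : mutually_independent P X.

Lemma measurable_cylinder_sum (D : {set J}) (s : seq J) (x : J -> RR) : {subset s <= D} ->
  measurable_fun [set: cylinderType X D] ((fun t => \sum_(j <- s) X j t * x j) : cylinderType X D -> mR).
Proof.
elim: s => [|j s IH] sD.
  by under eq_fun do rewrite big_nil; exact: measurable_cst.
under eq_fun do rewrite big_cons.
apply: measurable_funD.
  by apply: measurable_funM => //; apply: measurable_coordinate; apply: sD; exact: mem_head.
by apply: IH => i si; apply: sD; rewrite in_cons si orbT.
Qed.

(** The numbers [al], [be], [ga] form a Cholesky factor of the Gram matrix of [x] and [x']: the pair
    of projections has the law of a triangular image of two independent Gaussians. In the induction,
    coordinate [j] is independent of the two partial sums, and [normal_pair_fold] absorbs it. *)
Lemma gaussian_pair_law (s : seq J) (x x' : J -> RR) : uniq s ->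
  (forall j (B : set mR), j \in s -> measurable B -> P (X j @^-1` B) = N B) ->
  exists al be ga : RR,
  [/\ 0 <= al /\ 0 <= ga, al ^+ 2 = \sum_(j <- s) x j ^+ 2, al * be = \sum_(j <- s) x j * x' j,
      be ^+ 2 + ga ^+ 2 = \sum_(j <- s) x' j ^+ 2 &
   forall f : mR * mR -> \bar RR, measurable_fun setT f -> (forall z, 0 <= f z)%E ->
   (\int[P]_t f ((\sum_(j <- s) X j t * x j)%R, (\sum_(j <- s) X j t * x' j)%R) =
   \int[N]_g1 \int[N]_g2 f ((al * g1)%R, (be * g1 + ga * g2)%R))%E].
Proof.
elim: s => [_ _|j s IH /= /andP[js us] lawX].
  exists 0, 0, 0; rewrite !big_nil; split; rewrite ?expr0n/= ?mulr0 ?addr0// => f mf f0.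
  under eq_integral do rewrite !big_nil.
  rewrite integral_cst// [X in (_ * X)%E]probability_setT mule1.
  under [RHS]eq_integral do under eq_integral do rewrite !mul0r addr0.
  by under [RHS]eq_integral do rewrite normal_integral_cst//; rewrite normal_integral_cst.
have [|al [be [ga [_ h1 h2 h3 h4]]]] := IH us.
  by move=> i B si mB; apply: lawX => //; rewrite in_cons si orbT.
have [al' [be' [ga' [e0 e1 e2 e3 e4]]]] := normal_pair_fold k0 al be ga (x j) (x' j).
exists al', be', ga'; rewrite !big_cons; split; first exact: e0.
- by rewrite e1 h1 addrC.
- by rewrite e2 h2 addrC.
- by rewrite e3 h3 addrC.
move=> f mf f0.
pose D := [set i in s]%SET.
pose S t : mR * mR := (\sum_(j <- s) X j t * x j, \sum_(j <- s) X j t * x' j).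
have sD : {subset s <= D} by move=> i; rewrite inE.
have mS : measurable_fun [set: cylinderType X D] (S : cylinderType X D -> (mR * mR)%type).
  by apply: measurable_fun_pair; exact: measurable_cylinder_sum.
have mS' : measurable_fun setT S := measurable_cylinder_fun mX mS.
have mj : measurable_fun [set: cylinderType X [set j]%SET] (X j : cylinderType X [set j]%SET -> mR).
  by apply: measurable_coordinate; rewrite inE.
pose F (w : (mR * mR) * mR) : \bar RR := f (w.1.1 + x j * w.2, w.1.2 + x' j * w.2).
have mF : measurable_fun setT F.
  by apply: (measurableT_comp mf); solve_measurable.
have F0 w : (0 <= F w)%E by exact: f0.
have lawj (B : set mR) : measurable B -> P (X j @^-1` B) = N B.
  by move=> mB; apply: lawX => //; exact: mem_head.
transitivity (\int[P]_t F (S t, X j t))%E.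
  apply: eq_integral => t _; rewrite /F /S/= !big_cons.
  by congr (f (_, _)); rewrite addrC; congr (_ + _); exact: mulrC.
rewrite (indep_integral (N := N) mS' (mX j) lawj _ mF F0); last first.
  move=> A1 A2 mA1 mA2; apply: (indep_preimage mX indX _ mS mj) => //.
  by move=> i; rewrite !inE; apply: contraL => /eqP ->.
have mG := measurable_inner_normal k mF F0.
have G0 z : (0 <= \int[N]_y F (z, y))%E by exact: integral_ge0.
rewrite (h4 _ mG G0) -e4//.
Qed.

End gaussian_projection.

(** * Gradient descent as a perturbed linear iteration *)

Lemma cauchy_schwarz_sum (R : realFieldType) (n : nat) (u v : 'I_n -> R) :
  (\sum_i u i * v i) ^+ 2 <= (\sum_i u i ^+ 2) * (\sum_i v i ^+ 2).
Proof.
(* Lagrange's identity: this sum is twice the gap in the inequality. *)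
have : 0 <= \sum_i \sum_j (u i * v j - u j * v i) ^+ 2.
  by apply: sumr_ge0 => i _; apply: sumr_ge0 => j _; exact: sqr_ge0.
have -> : \sum_i \sum_j (u i * v j - u j * v i) ^+ 2 =
    \sum_i \sum_j (u i ^+ 2 * v j ^+ 2 + v i ^+ 2 * u j ^+ 2 - 2 * ((u i * v i) * (u j * v j))).
  by apply: eq_bigr => i _; apply: eq_bigr => j _; ring.
have E (f g : 'I_n -> R) : \sum_i \sum_j f i * g j = (\sum_i f i) * (\sum_j g j).
  by rewrite mulr_suml; apply: eq_bigr => i _; rewrite mulr_sumr.
under eq_bigr => i _ do rewrite sumrB big_split/=.
rewrite sumrB big_split/=.
have -> : \sum_i \sum_j 2 * ((u i * v i) * (u j * v j)) = 2 * (\sum_i u i * v i) ^+ 2.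
  by rewrite expr2 -E mulr_sumr; apply: eq_bigr => i _; rewrite mulr_sumr.
by rewrite !E; lra.
Qed.

Lemma norm2_ge0 (n : nat) (v : 'I_n -> RR) : 0 <= norm2 v.
Proof. exact: sqrtr_ge0. Qed.

Lemma sqr_norm2 (n : nat) (v : 'I_n -> RR) : norm2 v ^+ 2 = \sum_i v i ^+ 2.
Proof. by rewrite sqr_sqrtr// sumr_ge0// => i _; exact: sqr_ge0. Qed.

Lemma norm2_le (n : nat) (v : 'I_n -> RR) (b : RR) : 0 <= b ->
  \sum_i v i ^+ 2 <= b ^+ 2 -> norm2 v <= b.
Proof. by move=> b0 vb; rewrite -(ler_pXn2r (_ : (0 < 2)%N)) ?nnegrE ?norm2_ge0// sqr_norm2. Qed.

Lemma norm_dotv_le (n : nat) (u v : 'I_n -> RR) : `|dotv u v| <= norm2 u * norm2 v.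
Proof.
rewrite -(ler_pXn2r (_ : (0 < 2)%N)) ?nnegrE ?mulr_ge0 ?norm2_ge0//.
by rewrite real_normK ?num_real// exprMn !sqr_norm2; exact: cauchy_schwarz_sum.
Qed.

Lemma norm2_triangle (n : nat) (u v : 'I_n -> RR) :
  norm2 (fun i => u i + v i) <= norm2 u + norm2 v.
Proof.
apply: norm2_le; first by rewrite addr_ge0 ?norm2_ge0.
have -> : \sum_i (u i + v i) ^+ 2 = \sum_i u i ^+ 2 + \sum_i v i ^+ 2 + 2 * dotv u v.
  rewrite /dotv mulr_sumr -!big_split/=; apply: eq_bigr => i _; ring.
rewrite sqrrD !sqr_norm2 -[X in _ <= _ + X + _]mulr_natl.
have := norm_dotv_le u v; have := ler_norm (dotv u v); lra.
Qed.

Lemma eq_norm2 (n : nat) (u v : 'I_n -> RR) : u =1 v -> norm2 u = norm2 v.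
Proof. by move=> uv; congr Num.sqrt; apply: eq_bigr => i _; rewrite uv. Qed.

Lemma norm2Z (n : nat) (c : RR) (u : 'I_n -> RR) : norm2 (fun i => c * u i) = `|c| * norm2 u.
Proof.
rewrite /norm2; under eq_bigr do rewrite exprMn.
by rewrite -mulr_sumr sqrtrM ?sqr_ge0// sqrtr_sqr.
Qed.

Lemma norm2_0 (n : nat) : norm2 (fun _ : 'I_n => 0) = 0.
Proof. by rewrite /norm2 big1 ?sqrtr0// => i _; rewrite expr0n. Qed.

Lemma norm2_sum (n : nat) (J : Type) (s : seq J) (f : J -> 'I_n -> RR) :
  norm2 (fun i => \sum_(j <- s) f j i) <= \sum_(j <- s) norm2 (f j).
Proof.
elim: s => [|j s IH].
  by rewrite big_nil (@eq_norm2 _ _ (fun _ => 0)) ?norm2_0// => i; rewrite big_nil.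
rewrite big_cons (@eq_norm2 _ _ (fun i => f j i + \sum_(j <- s) f j i)); last first.
  by move=> i; rewrite big_cons.
by apply: le_trans (norm2_triangle _ _) _; rewrite lerD2l.
Qed.

(** The Frobenius norm bounds the operator norm. The hypothesis is an entrywise domination because
    the flip error is known only through absolute bounds. *)
Lemma norm2_mulmx (n : nat) (M : 'I_n -> 'I_n -> RR) (e z : 'I_n -> RR) :
  (forall i, `|e i| <= \sum_j M i j * `|z j|) ->
  norm2 e <= Num.sqrt (\sum_i \sum_j M i j ^+ 2) * norm2 z.
Proof.
move=> eM; apply: norm2_le; first by rewrite mulr_ge0 ?norm2_ge0 ?sqrtr_ge0.
rewrite exprMn sqr_norm2 sqr_sqrtr; last first.
  by apply: sumr_ge0 => i _; apply: sumr_ge0 => j _; exact: sqr_ge0.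
rewrite mulr_suml; apply: ler_sum => i _.
have -> : \sum_j z j ^+ 2 = \sum_j `|z j| ^+ 2.
  by apply: eq_bigr => j _; rewrite real_normK ?num_real.
apply: le_trans (cauchy_schwarz_sum _ _).
by rewrite -real_normK ?num_real// ler_pXn2r ?nnegrE// (le_trans _ (eM i)).
Qed.

Lemma sum_norm_le (n : nat) (z : 'I_n -> RR) : \sum_i `|z i| <= Num.sqrt n%:R * norm2 z.
Proof.
rewrite -(ler_pXn2r (_ : (0 < 2)%N)) ?nnegrE ?mulr_ge0 ?norm2_ge0 ?sqrtr_ge0 ?sumr_ge0//.
rewrite exprMn sqr_norm2 sqr_sqrtr ?ler0n//.
have := cauchy_schwarz_sum (fun _ : 'I_n => 1) (fun i => `|z i|).
under eq_bigr do rewrite mul1r.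
under [X in X * _]eq_bigr do rewrite expr1n.
rewrite sumr_const card_ord => /le_trans; apply.
rewrite le_eqVlt; apply/orP; left; apply/eqP; congr (_ * _).
by apply: eq_bigr => i _; rewrite real_normK ?num_real.
Qed.

(** Replaces the Frobenius norm by the sum of the entries, since the flip counts are controlled by a
    first moment. *)
Lemma sqrt_sum_sqr_le (n : nat) (M : 'I_n -> 'I_n -> RR) : (forall i j, 0 <= M i j) ->
  Num.sqrt (\sum_i \sum_j M i j ^+ 2) <= \sum_i \sum_j M i j.
Proof.
move=> M0.
have sqle (s : seq ('I_n * 'I_n)) (f : 'I_n * 'I_n -> RR) : (forall p, 0 <= f p) ->
    \sum_(p <- s) f p ^+ 2 <= (\sum_(p <- s) f p) ^+ 2.
  move=> f0; elim: s => [|p s IH]; first by rewrite !big_nil expr0n.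
  have : 0 <= \sum_(j <- s) f j by apply: sumr_ge0.
  by rewrite !big_cons; have := f0 p; nra.
have S0 : 0 <= \sum_i \sum_j M i j by apply: sumr_ge0 => i _; apply: sumr_ge0.
rewrite -(ler_pXn2r (_ : (0 < 2)%N)) ?nnegrE ?sqrtr_ge0//.
rewrite sqr_sqrtr; last by apply: sumr_ge0 => i _; apply: sumr_ge0 => j _; exact: sqr_ge0.
by rewrite !pair_big/=; exact: (sqle _ (fun p => M p.1 p.2)).
Qed.

(** * Exact linear iteration in the eigenbasis *)

Section spectral.
Variables (n : nat) (H : 'M[RR]_n) (lam : 'I_n -> RR) (v : 'I_n -> 'I_n -> RR).
Hypothesis vorth : forall i j, dotv (v i) (v j) = (i == j)%:R.
Hypothesis Hdec : forall p q, H p q = \sum_(i < n) lam i * v i p * v i q.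

Definition mulv (z : 'I_n -> RR) (p : 'I_n) : RR := \sum_q H p q * z q.

(** A square matrix with orthonormal rows has orthonormal columns. *)
Lemma eigenbasis_complete p q : \sum_i v i p * v i q = (p == q)%:R.
Proof.
pose V : 'M[RR]_n := \matrix_(i, j) v i j.
have VV : V *m V^T = 1%:M.
  by apply/matrixP => i j; rewrite !mxE -vorth /dotv; apply: eq_bigr => k _; rewrite !mxE.
have /matrixP/(_ p q) := mulmx1C VV.
by rewrite !mxE => <-; apply: eq_bigr => i _; rewrite !mxE.
Qed.

Lemma eigenbasis_parseval (z : 'I_n -> RR) : \sum_i dotv (v i) z ^+ 2 = \sum_p z p ^+ 2.
Proof.
transitivity (\sum_p \sum_q z p * z q * \sum_i v i p * v i q).
  under eq_bigr do rewrite expr2 /dotv mulr_suml.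
  rewrite exchange_big/=; apply: eq_bigr => p _.
  under eq_bigr do rewrite mulr_sumr.
  rewrite exchange_big/=; apply: eq_bigr => q _.
  by rewrite mulr_sumr; apply: eq_bigr => i _; ring.
apply: eq_bigr => p _; rewrite (bigD1 p)//= [X in _ + X]big1 ?addr0.
  by rewrite eigenbasis_complete eqxx mulr1 expr2.
by move=> q qp; rewrite eigenbasis_complete eq_sym (negbTE qp) mulr0.
Qed.

Lemma dotv_eigen i (z : 'I_n -> RR) : dotv (v i) (mulv z) = lam i * dotv (v i) z.
Proof.
rewrite /dotv /mulv.
transitivity (\sum_j \sum_q lam j * v j q * z q * (\sum_p v i p * v j p)).
  transitivity (\sum_p \sum_q \sum_j v i p * (lam j * v j p * v j q) * z q).
    apply: eq_bigr => p _; rewrite mulr_sumr; apply: eq_bigr => q _.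
    by rewrite Hdec mulr_suml mulr_sumr; apply: eq_bigr => j _; ring.
  rewrite [RHS]exchange_big/= exchange_big/=; apply: eq_bigr => q _.
  rewrite exchange_big/=; apply: eq_bigr => j _.
  by rewrite mulr_sumr; apply: eq_bigr => p _; ring.
rewrite (bigD1 i)//= [X in _ + X]big1 ?addr0.
  rewrite mulr_sumr; apply: eq_bigr => q _.
  by have := vorth i i; rewrite /dotv eqxx => ->; rewrite mulr1; ring.
move=> j ji; rewrite big1// => q _; have := vorth i j; rewrite /dotv eq_sym (negbTE ji) => ->.
by rewrite mulr0.
Qed.

(** The theorem describes lambda_0 as the least eigenvalue; this turns that into a lower bound on
    the coefficients [lam i] of the given decomposition. *)
Lemma lam_eigenvalue i : eigenvalue H (lam i).
Proof.
apply/eigenvalueP; exists (\row_j v i j).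
  apply/rowP => q; rewrite !mxE.
  under eq_bigr do rewrite mxE Hdec mulr_sumr.
  rewrite exchange_big/= (bigD1 i)//= [X in _ + X]big1 ?addr0.
    have := vorth i i; rewrite /dotv eqxx => vi.
    transitivity (lam i * v i q * \sum_p v i p * v i p); last by rewrite vi mulr1.
    by rewrite mulr_sumr; apply: eq_bigr => p _; ring.
  move=> j ji; have := vorth i j; rewrite /dotv eq_sym (negbTE ji) => vij.
  transitivity (lam j * v j q * \sum_p v i p * v j p); last by rewrite vij mulr0.
  by rewrite mulr_sumr; apply: eq_bigr => p _; ring.
apply/eqP => /rowP v0; have := vorth i i; rewrite eqxx /dotv big1 => [/esym/eqP|j _].
  by rewrite oner_eq0.
by have := v0 j; rewrite !mxE => ->; rewrite mul0r.
Qed.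

(** With nonnegative eigenvalues the trace bounds each of them from above, which is how the
    condition on the step size gives [eta * lam i <= 1]. *)
Lemma sum_lam : \sum_i lam i = \tr H.
Proof.
rewrite /mxtrace; under [RHS]eq_bigr do rewrite Hdec.
rewrite exchange_big/=; apply: eq_bigr => i _.
have := vorth i i; rewrite /dotv eqxx => vi.
transitivity (lam i * \sum_p v i p * v i p); first by rewrite vi mulr1.
by rewrite mulr_sumr; apply: eq_bigr => p _; ring.
Qed.

Variables (lambda0 eta : RR).
Hypothesis lam_ge : forall i, lambda0 <= lam i.
Hypothesis eta_ge0 : 0 <= eta.
Hypothesis eta_lam : forall i, eta * lam i <= 1.
Hypothesis eta_lambda0 : eta * lambda0 <= 1.

Lemma dotv_descent i (z : 'I_n -> RR) :
  dotv (v i) (fun p => z p - eta * mulv z p) = (1 - eta * lam i) * dotv (v i) z.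
Proof.
rewrite mulrBl mul1r -mulrA -dotv_eigen /dotv mulr_sumr -sumrB.
by apply: eq_bigr => p _; ring.
Qed.

(** Each eigencoordinate is multiplied by a factor in [0, 1 - eta lambda_0]; [eta_lam] gives the
    lower end, without which the squares could not be compared. *)
Lemma norm2_descent (z : 'I_n -> RR) :
  norm2 (fun p => z p - eta * mulv z p) <= (1 - eta * lambda0) * norm2 z.
Proof.
have c0 : 0 <= 1 - eta * lambda0 by rewrite subr_ge0.
apply: norm2_le; first by rewrite mulr_ge0 ?norm2_ge0.
rewrite -(eigenbasis_parseval (fun p => z p - eta * mulv z p)).
rewrite exprMn sqr_norm2 -(eigenbasis_parseval z) mulr_sumr.
apply: ler_sum => i _; rewrite dotv_descent exprMn ler_wpM2r ?sqr_ge0//.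
have := eta_lam i; have := ler_wpM2l eta_ge0 (lam_ge i).
move=> h1 h2; have h3 : 0 <= 1 - eta * lam i by rewrite subr_ge0.
by rewrite ler_pXn2r ?nnegrE//; rewrite lerD2l lerN2.
Qed.

Fixpoint linear_iter (y : 'I_n -> RR) (k : nat) : 'I_n -> RR :=
  match k with
  | 0 => fun p => - y p
  | k'.+1 => fun p => linear_iter y k' p - eta * mulv (linear_iter y k') p
  end.

Lemma norm2_linear_iter (y : 'I_n -> RR) k :
  norm2 (linear_iter y k) =
  Num.sqrt (\sum_(i < n) (1 - eta * lam i) ^+ (2 * k) * (dotv (v i) y) ^+ 2).
Proof.
rewrite /norm2 -eigenbasis_parseval; congr Num.sqrt; apply: eq_bigr => i _.
have -> : dotv (v i) (linear_iter y k) = - (1 - eta * lam i) ^+ k * dotv (v i) y.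
  elim: k => [|k IH] /=.
    by rewrite expr0 mulN1r /dotv -sumrN; apply: eq_bigr => p _; rewrite mulrN.
  by rewrite dotv_descent IH exprS; ring.
by rewrite exprMn sqrrN -exprM mulnC.
Qed.

End spectral.

(** * One step of gradient descent *)

Definition activation (d : nat) (w x : 'I_d -> RR) : RR := if 0 <= dotv w x then 1 else 0.

Lemma dotv_update (d n : nat) (w x' : 'I_d -> RR) (c : RR) (f : 'I_n -> RR) (x : 'I_n -> 'I_d -> RR) :
  dotv (fun j => w j - c * \sum_i f i * x i j) x' =
  dotv w x' - c * \sum_i f i * dotv (x i) x'.
Proof.
rewrite /dotv; under eq_bigr do rewrite mulrBl.
rewrite sumrB; congr (_ - _).
under eq_bigr do rewrite -mulrA mulr_suml.
rewrite -mulr_sumr; congr (_ * _); rewrite exchange_big/=; apply: eq_bigr => i _.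
by rewrite mulr_sumr; apply: eq_bigr => j _; rewrite mulrA.
Qed.

Lemma dotvC (d : nat) (u v : 'I_d -> RR) : dotv u v = dotv v u.
Proof. by apply: eq_bigr => i _; rewrite mulrC. Qed.

Lemma relu_lipschitz (s t : RR) : `|relu s - relu t| <= `|s - t|.
Proof.
rewrite /relu; have [s0|s0] := ltP s 0; have [t0|t0] := ltP t 0.
- by rewrite subrr normr0.
- rewrite sub0r normrN (ger0_norm t0) ler0_norm; lra.
- rewrite subr0 (ger0_norm s0) ger0_norm; lra.
- by [].
Qed.

Section descent.
Variables (n m d : nat) (eta : RR) (x : 'I_n -> 'I_d -> RR) (y : 'I_n -> RR).
Variables (a : 'I_m -> RR) (W0 : 'I_m -> 'I_d -> RR) (rad : RR).
Hypothesis x_unit : forall i, dotv (x i) (x i) = 1.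
Hypothesis a_sign : forall r, a r = 1 \/ a r = -1.
Hypothesis m_gt0 : (0 < m)%N.
Hypothesis eta_gt0 : 0 < eta.

(* 1 when neuron r may change its activation on input i within distance rad. *)
Definition flip (r : 'I_m) (i : 'I_n) : RR := if `|dotv (W0 r) (x i)| <= rad then 1 else 0.
Definition flips (i : 'I_n) : RR := \sum_r flip r i.
Definition gram0 (i j : 'I_n) : RR :=
  m%:R^-1 * \sum_r dotv (x i) (x j) * (activation (W0 r) (x i) * activation (W0 r) (x j)).
Definition close (W : 'I_m -> 'I_d -> RR) := forall r, norm2 (fun j => W r j - W0 r j) <= rad.

Lemma norm2_x i : norm2 (x i) = 1.
Proof. by rewrite /norm2 -[RHS]sqrtr1 -(x_unit i); congr Num.sqrt; apply: eq_bigr => j _; rewrite expr2. Qed.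

Lemma norm_gram_le1 i j : `|dotv (x i) (x j)| <= 1.
Proof. by apply: le_trans (norm_dotv_le _ _) _; rewrite !norm2_x mulr1. Qed.

Lemma flip01 r i : flip r i = 0 \/ flip r i = 1.
Proof. by rewrite /flip; case: ifP; [right|left]. Qed.

Lemma flip_ge0 r i : 0 <= flip r i.
Proof. by case: (flip01 r i) => ->. Qed.

Lemma norm_activation_le1 w i : `|activation w (x i)| <= 1.
Proof. by rewrite /activation; case: ifP; rewrite ?normr1 ?normr0. Qed.

Lemma close_dotv W r i : close W -> `|dotv (W r) (x i) - dotv (W0 r) (x i)| <= rad.
Proof.
move=> cW; have -> : dotv (W r) (x i) - dotv (W0 r) (x i) = dotv (fun j => W r j - W0 r j) (x i).
  by rewrite /dotv -sumrB; apply: eq_bigr => j _; rewrite mulrBl.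
by apply: le_trans (norm_dotv_le _ _) _; rewrite norm2_x mulr1; exact: cW.
Qed.

Lemma activation_stable W r i : close W ->
  `|activation (W r) (x i) - activation (W0 r) (x i)| <= flip r i.
Proof.
move=> cW; have := close_dotv r i cW; rewrite /activation /flip.
set s := dotv (W r) (x i); set s0 := dotv (W0 r) (x i).
have [h|h] := leP `|s0| rad.
  by move=> _; case: ifP; case: ifP; rewrite ?subrr ?subr0 ?sub0r ?normrN ?normr1 ?normr0.
rewrite ler_norml => /andP[h1 h2]; move: h.
have [p0|p0] := lerP 0 s0.
  rewrite (ger0_norm p0) => h; have -> : 0 <= s by lra.
  by rewrite subrr normr0.
rewrite (ltr0_norm p0) => h; have /lt_geF -> : s < 0 by lra.
by rewrite subrr normr0.
Qed.

Lemma relu_unflipped W W' r i : close W -> close W' -> flip r i = 0 ->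
  relu (dotv (W' r) (x i)) - relu (dotv (W r) (x i)) =
  activation (W0 r) (x i) * (dotv (W' r) (x i) - dotv (W r) (x i)).
Proof.
move=> cW cW'; have := close_dotv r i cW; have := close_dotv r i cW'.
rewrite /activation /flip /relu.
set s := dotv (W r) (x i); set s' := dotv (W' r) (x i); set s0 := dotv (W0 r) (x i).
move=> /ler_normlP[h1 h2] /ler_normlP[h3 h4].
have [h|h] := leP `|s0| rad; first by move/eqP; rewrite oner_eq0.
move=> _; move: h.
have [p0|p0] := lerP 0 s0.
  rewrite (ger0_norm p0) => h; have /lt_geF hs : 0 < s by lra.
  have /lt_geF hs' : 0 < s' by lra.
  rewrite mul1r !maxEge.
  have -> : 0 <= s by lra.
  have -> : 0 <= s' by lra.
  by [].
rewrite (ltr0_norm p0) => h.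
rewrite mul0r !maxElt.
have -> : s < 0 by lra.
have -> : s' < 0 by lra.
by rewrite subrr.
Qed.

Definition residual (W : 'I_m -> 'I_d -> RR) (i : 'I_n) : RR := net a W (x i) - y i.

Definition gd_step (W : 'I_m -> 'I_d -> RR) : 'I_m -> 'I_d -> RR :=
  fun r j => W r j - eta * (a r / Num.sqrt (m%:R)) *
    \sum_(i < n) residual W i * activation (W r) (x i) * x i j.

Let sqm : RR := Num.sqrt (m%:R).

Lemma sqrt_m_gt0 : 0 < sqm. Proof. by rewrite sqrtr_gt0 ltr0n. Qed.

Lemma sqrt_m_sqr : sqm * sqm = m%:R. Proof. by rewrite -expr2 sqr_sqrtr ?ler0n. Qed.

Lemma norm_a r : `|a r| = 1.
Proof. by case: (a_sign r) => ->; rewrite ?normrN normr1. Qed.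

Lemma gd_step_dotv W r i :
  dotv (gd_step W r) (x i) - dotv (W r) (x i) =
  - (eta * (a r / sqm) * \sum_j residual W j * activation (W r) (x j) * dotv (x j) (x i)).
Proof. by rewrite dotv_update addrAC subrr add0r. Qed.

Lemma norm2_gd_step W r :
  norm2 (fun j => gd_step W r j - W r j) <= eta / sqm * (Num.sqrt n%:R * norm2 (residual W)).
Proof.
have -> : norm2 (fun j => gd_step W r j - W r j) =
   norm2 (fun j => (- (eta * (a r / sqm))) * \sum_i residual W i * activation (W r) (x i) * x i j).
  by apply: eq_norm2 => j; rewrite /gd_step addrAC subrr add0r mulNr.
rewrite norm2Z normrN !normrM norm_a mul1r (gtr0_norm eta_gt0) normfV (gtr0_norm sqrt_m_gt0).
apply: ler_wpM2l; first by apply: divr_ge0; apply: ltW => //; exact: sqrt_m_gt0.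
apply: le_trans (norm2_sum _ _) _; apply: le_trans (sum_norm_le _).
apply: ler_sum => i _; rewrite norm2Z norm2_x mulr1 normrM ler_piMr//.
exact: norm_activation_le1.
Qed.

(* If neuron r cannot flip on input i, relu is linear between both weights and only
   the activations on the inputs j contribute; otherwise both terms are bounded. *)
Lemma gd_neuron W r i : close W -> close (gd_step W) ->
  `|a r / sqm * (relu (dotv (gd_step W r) (x i)) - relu (dotv (W r) (x i))) +
    eta / m%:R * \sum_j residual W j * (dotv (x i) (x j) * (activation (W0 r) (x i) * activation (W0 r) (x j)))| <=
  eta / m%:R * \sum_j `|residual W j| * (2 * flip r i + flip r j).
Proof.
move=> cW cW'.
have em0 : 0 <= eta / m%:R by rewrite divr_ge0 ?ler0n ?ltW.
have aa : a r * a r = 1 by case: (a_sign r) => ->; ring.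
have emE : a r / sqm * (eta * (a r / sqm)) = eta / m%:R.
  rewrite -sqrt_m_sqr invfM; transitivity ((a r * a r) * (eta * (sqm^-1 * sqm^-1))); first by ring.
  by rewrite aa mul1r.
case: (flip01 r i) => fl.
  rewrite (relu_unflipped cW cW' fl) gd_step_dotv fl mulr0.
  set A0 := activation (W0 r) (x i).
  have -> : a r / sqm * (A0 * - (eta * (a r / sqm) * \sum_j residual W j * activation (W r) (x j) * dotv (x j) (x i))) +
     eta / m%:R * \sum_j residual W j * (dotv (x i) (x j) * (A0 * activation (W0 r) (x j))) =
     eta / m%:R * \sum_j residual W j * (dotv (x i) (x j) * A0) * (activation (W0 r) (x j) - activation (W r) (x j)).
    rewrite -emE.
    transitivity (a r / sqm * (eta * (a r / sqm)) * (\sum_j residual W j * (dotv (x i) (x j) * (A0 * activation (W0 r) (x j))) - A0 * \sum_j residual W j * activation (W r) (x j) * dotv (x j) (x i))).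
      by ring.
    congr (_ * _); rewrite mulr_sumr -sumrB; apply: eq_bigr => j _.
    by rewrite (dotvC (x j)); ring.
  rewrite normrM (ger0_norm em0) ler_wpM2l//.
  apply: le_trans (ler_norm_sum _ _ _) _; apply: ler_sum => j _.
  rewrite !normrM add0r -mulrA ler_wpM2l//.
  have h1 : `|dotv (x i) (x j)| * `|A0| <= 1.
    by rewrite -[leRHS]mulr1 ler_pM ?norm_gram_le1 ?norm_activation_le1.
  have h2 := activation_stable r j cW; rewrite distrC in h2.
  by rewrite -[leRHS]mul1r ler_pM// mulr_ge0.
rewrite fl.
apply: le_trans (ler_normD _ _) _.
have -> : eta / m%:R * (\sum_j `|residual W j| * (2 * 1 + flip r j)) =
  eta / m%:R * (\sum_j `|residual W j|) + eta / m%:R * (\sum_j `|residual W j| * (1 + flip r j)).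
  by rewrite -mulrDr -big_split/=; congr (_ * _); apply: eq_bigr => j _; ring.
apply: lerD.
  rewrite normrM; apply: le_trans (ler_wpM2l (normr_ge0 _) (relu_lipschitz _ _)) _.
  rewrite -normrM gd_step_dotv.
  rewrite (_ : a r / sqm * _ = - (eta / m%:R * \sum_j residual W j * activation (W r) (x j) * dotv (x j) (x i))); last first.
    by rewrite -emE; ring.
  rewrite normrN normrM (ger0_norm em0) ler_wpM2l//.
  apply: le_trans (ler_norm_sum _ _ _) _; apply: ler_sum => j _.
  rewrite !normrM -mulrA ler_piMr//.
  by rewrite -[leRHS]mulr1 ler_pM ?norm_gram_le1 ?norm_activation_le1.
rewrite normrM (ger0_norm em0) ler_wpM2l//.
apply: le_trans (ler_norm_sum _ _ _) _; apply: ler_sum => j _.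
rewrite normrM ler_wpM2l// !normrM.
apply: (@le_trans _ _ 1); last by rewrite lerDl flip_ge0.
rewrite -[leRHS]mulr1 ler_pM ?mulr_ge0 ?norm_gram_le1//.
by rewrite -[leRHS]mulr1 ler_pM ?norm_activation_le1.
Qed.

Lemma gd_residual W i : close W -> close (gd_step W) ->
  `|residual (gd_step W) i - residual W i + eta * \sum_j gram0 i j * residual W j| <=
  \sum_j (eta / m%:R * (2 * flips i + flips j)) * `|residual W j|.
Proof.
move=> cW cW'.
have -> : residual (gd_step W) i - residual W i + eta * \sum_j gram0 i j * residual W j =
  \sum_r (a r / sqm * (relu (dotv (gd_step W r) (x i)) - relu (dotv (W r) (x i))) +
    eta / m%:R * \sum_j residual W j * (dotv (x i) (x j) * (activation (W0 r) (x i) * activation (W0 r) (x j)))).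
  rewrite big_split/=; congr (_ + _).
    rewrite {1 2}/residual /net -/sqm opprD opprK addrACA addNr addr0 -mulrBr -sumrB mulr_sumr.
    by apply: eq_bigr => r _; ring.
  rewrite -mulr_sumr -mulrA; congr (_ * _).
  rewrite exchange_big/= mulr_sumr; apply: eq_bigr => j _.
  by rewrite /gram0 -mulrA; congr (_ * _); rewrite mulr_suml; apply: eq_bigr => r _; ring.
apply: le_trans (ler_norm_sum _ _ _) _.
apply: (@le_trans _ _ (\sum_r eta / m%:R * \sum_j `|residual W j| * (2 * flip r i + flip r j))).
  by apply: ler_sum => r _; exact: gd_neuron.
rewrite -mulr_sumr exchange_big/= mulr_sumr; apply: ler_sum => j _.
rewrite -mulr_sumr big_split/= -mulr_sumr /flips.
by rewrite le_eqVlt; apply/orP; left; apply/eqP; ring.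
Qed.

End descent.

(** * Induction over the iterations *)

Section convergence.
Variables (n m d : nat) (eta : RR) (x : 'I_n -> 'I_d -> RR) (y : 'I_n -> RR).
Variables (a : 'I_m -> RR) (W0 : 'I_m -> 'I_d -> RR) (rad : RR).
Variables (H : 'M[RR]_n) (lam : 'I_n -> RR) (v : 'I_n -> 'I_n -> RR) (lambda0 omega : RR).
Hypothesis x_unit : forall i, dotv (x i) (x i) = 1.
Hypothesis a_sign : forall r, a r = 1 \/ a r = -1.
Hypothesis m_gt0 : (0 < m)%N.
Hypothesis eta_gt0 : 0 < eta.
Hypothesis vorth : forall i j, dotv (v i) (v j) = (i == j)%:R.
Hypothesis Hdec : forall p q, H p q = \sum_(i < n) lam i * v i p * v i q.
Hypothesis lambda0_gt0 : 0 < lambda0.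
Hypothesis lam_ge : forall i, lambda0 <= lam i.
Hypothesis eta_lam : forall i, eta * lam i <= 1.
Hypothesis eta_lambda0 : eta * lambda0 <= 1.

Local Notation z0 := (norm2 (residual x y a W0)).
Local Notation W k := (gd_iter eta x y a W0 k).
Local Notation z k := (residual x y a (W k)).

Hypothesis rad_ge : 2 * Num.sqrt n%:R * z0 / (Num.sqrt m%:R * lambda0) <= rad.
Hypothesis omega_ge :
  Num.sqrt (\sum_i \sum_j (gram0 x W0 i j - H i j) ^+ 2) +
  3 * n%:R * (\sum_i flips x W0 rad i) / m%:R <= omega.
Hypothesis omega_le : omega <= lambda0 / 2.

Lemma perturbed_descent V : close W0 rad V -> close W0 rad (gd_step eta x y a V) ->
  norm2 (fun i => residual x y a (gd_step eta x y a V) i -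
     (residual x y a V i - eta * mulv H (residual x y a V) i)) <=
  eta * omega * norm2 (residual x y a V).
Proof.
move=> cV cV'; set r := residual x y a V; set r' := residual x y a _.
(* [e1] is the error due to possible flips, [e2] the one due to replacing the initial Gram matrix by
   [H]. *)
pose e1 i := r' i - r i + eta * \sum_j gram0 x W0 i j * r j.
pose e2 i := - eta * \sum_j (gram0 x W0 i j - H i j) * r j.
have -> : norm2 (fun i => r' i - (r i - eta * mulv H r i)) = norm2 (fun i => e1 i + e2 i).
  apply: eq_norm2 => i; rewrite /e1 /e2 /mulv.
  under [X in - eta * X]eq_bigr do rewrite mulrBl.
  by rewrite sumrB; ring.
apply: le_trans (norm2_triangle _ _) _.
have n0 := norm2_ge0 r.
have h1 : norm2 e1 <= eta * (3 * n%:R * (\sum_i flips x W0 rad i) / m%:R) * norm2 r.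
  have M0 i j : 0 <= eta / m%:R * (2 * flips x W0 rad i + flips x W0 rad j).
    have f0 k : 0 <= flips x W0 rad k by apply: sumr_ge0 => q _; exact: flip_ge0.
    by rewrite mulr_ge0 ?divr_ge0 ?ler0n ?(ltW eta_gt0)// addr_ge0 ?mulr_ge0.
  apply: le_trans (norm2_mulmx (M := fun i j => eta / m%:R * (2 * flips x W0 rad i + flips x W0 rad j)) (z := r) _) _.
    by move=> i; exact: gd_residual.
  rewrite ler_wpM2r//; apply: le_trans (sqrt_sum_sqr_le M0) _.
  (* Summed over i and j, the weights 2 flips i + flips j count every flip 2 n + n times, whence the
     factor 3 n in [omega_ge]. *)
  rewrite le_eqVlt; apply/orP; left; apply/eqP.
  under eq_bigr do rewrite -mulr_sumr big_split/= sumr_const card_ord.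
  rewrite -mulr_sumr big_split/= sumr_const card_ord.
  have -> : \sum_i 2 * flips x W0 rad i *+ n = 2 * n%:R * \sum_i flips x W0 rad i.
    by rewrite mulr_sumr; apply: eq_bigr => i _; rewrite -mulr_natr; ring.
  by rewrite -mulr_natr; ring.
have h2 : norm2 e2 <= eta * Num.sqrt (\sum_i \sum_j (gram0 x W0 i j - H i j) ^+ 2) * norm2 r.
  rewrite /e2 norm2Z normrN (gtr0_norm eta_gt0) -mulrA ler_wpM2l ?(ltW eta_gt0)//.
  have -> : \sum_i \sum_j (gram0 x W0 i j - H i j) ^+ 2 = \sum_i \sum_j `|gram0 x W0 i j - H i j| ^+ 2.
    by apply: eq_bigr => i _; apply: eq_bigr => j _; rewrite real_normK ?num_real.
  apply: (norm2_mulmx (M := fun i j => `|gram0 x W0 i j - H i j|)) => i.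
  apply: le_trans (ler_norm_sum _ _ _) _; apply: ler_sum => j _; by rewrite normrM.
apply: le_trans (lerD h1 h2) _.
by rewrite -mulrDl -mulrDr ler_wpM2r// ler_wpM2l ?(ltW eta_gt0)// addrC.
Qed.

(* The first bound telescopes: a step of length C eta lambda0 |z| / 2 is paid for by
   the decrease of |z|. *)
Lemma gd_invariant k :
  [/\ forall r, norm2 (fun j => W k r j - W0 r j) <=
        2 * Num.sqrt n%:R / (Num.sqrt m%:R * lambda0) * (z0 - norm2 (z k)),
      norm2 (z k) <= z0 &
      norm2 (fun i => z k i - linear_iter H eta y k i) <=
        norm2 (fun i => net a W0 (x i)) + omega * z0 / lambda0].
Proof.
have sm0 := sqrt_m_gt0 m_gt0.
have el1 : eta * lambda0 <= 1 := eta_lambda0.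
have om2 : omega <= lambda0 / 2 := omega_le.
set C := 2 * Num.sqrt n%:R / (Num.sqrt m%:R * lambda0).
have C0 : 0 <= C by rewrite divr_ge0 ?mulr_ge0 ?sqrtr_ge0 ?(ltW lambda0_gt0).
have om0 : 0 <= omega.
  apply: le_trans omega_ge; rewrite addr_ge0 ?sqrtr_ge0 ?divr_ge0 ?ler0n// mulr_ge0 ?mulr_ge0//.
  by apply: sumr_ge0 => i _; apply: sumr_ge0 => r _; exact: flip_ge0.
have radC : C * z0 <= rad by rewrite /C mulrAC.
elim: k => [|k [IH1 IH2 IH3]].
  split => //.
  - by move=> r; rewrite subrr mulr0 (@eq_norm2 _ _ (fun _ => 0)) ?norm2_0// => j; rewrite subrr.
  - rewrite (@eq_norm2 _ _ (fun i => net a W0 (x i))); last by move=> i; rewrite /= /residual opprK subrK.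
    by rewrite lerDl divr_ge0 ?(ltW lambda0_gt0)// mulr_ge0 ?norm2_ge0.
set zk := norm2 (z k) in IH1 IH2 *.
have zk0 : 0 <= zk by exact: norm2_ge0.
have ck : close W0 rad (W k).
  move=> r; apply: le_trans (IH1 r) _; apply: le_trans radC.
  by rewrite ler_wpM2l// gerBl.
have step r : norm2 (fun j => W k.+1 r j - W k r j) <= C * (eta * lambda0 / 2) * zk.
  apply: le_trans (norm2_gd_step y x_unit a_sign m_gt0 eta_gt0 (W k) r) _.
  rewrite le_eqVlt; apply/orP; left; apply/eqP; rewrite /C /zk.
  by field; rewrite !lt0r_neq0.
have tri r : norm2 (fun j => W k.+1 r j - W0 r j) <= C * (z0 - zk) + C * (eta * lambda0 / 2) * zk.
  rewrite (@eq_norm2 _ _ (fun j => (W k r j - W0 r j) + (W k.+1 r j - W k r j))); last first.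
    by move=> j; rewrite [RHS]addrC addrA subrK.
  by apply: le_trans (norm2_triangle _ _) _; apply: lerD.
(* [perturbed_descent] needs both ends of the step within [rad], before the decrease of |z| is
   available; [eta * lambda0 / 2 <= 1] is enough for that. *)
have ck1 : close W0 rad (gd_step eta x y a (W k)).
  move=> r; apply: le_trans (tri r) _; apply: le_trans radC.
  rewrite -mulrA -mulrDr ler_wpM2l//.
  have : eta * lambda0 / 2 * zk <= 1 * zk by apply: ler_wpM2r => //; lra.
  by lra.
have pert := perturbed_descent ck ck1; rewrite -/zk in pert.
have contr : norm2 (z k.+1) <= (1 - eta * lambda0 / 2) * zk.
  rewrite (@eq_norm2 _ _ (fun i => (z k i - eta * mulv H (z k) i) + (z k.+1 i - (z k i - eta * mulv H (z k) i)))); last first.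
    by move=> i; rewrite addrC subrK.
  apply: le_trans (norm2_triangle _ _) _.
  have dsc := norm2_descent vorth Hdec lam_ge (ltW eta_gt0) eta_lam eta_lambda0 (z k); rewrite -/zk in dsc.
  apply: le_trans (lerD dsc pert) _.
  rewrite -mulrDl ler_wpM2r//.
  have : eta * omega <= eta * (lambda0 / 2) by rewrite ler_wpM2l// ltW.
  by lra.
have el0 : 0 <= eta * lambda0 / 2 by rewrite divr_ge0 ?mulr_ge0 ?(ltW lambda0_gt0) ?(ltW eta_gt0).
split.
- move=> r; apply: le_trans (tri r) _; rewrite -mulrA -mulrDr ler_wpM2l//.
  by move: contr; rewrite mulrBl mul1r; lra.
- by apply: le_trans contr _; have := mulr_ge0 el0 zk0; rewrite mulrBl mul1r; lra.
- set p := linear_iter H eta y k in IH3 *.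
  set D := norm2 _ + _ in IH3 *.
  rewrite (@eq_norm2 _ _ (fun i => ((z k i - p i) - eta * mulv H (fun q => z k q - p q) i) + (z k.+1 i - (z k i - eta * mulv H (z k) i)))); last first.
    move=> i; rewrite /= -/p.
    have -> : mulv H (fun q => z k q - p q) i = mulv H (z k) i - mulv H p i.
      by rewrite /mulv -sumrB; apply: eq_bigr => q _; rewrite mulrBr.
    by ring.
  apply: le_trans (norm2_triangle _ _) _.
  have dsc := norm2_descent vorth Hdec lam_ge (ltW eta_gt0) eta_lam eta_lambda0 (fun q => z k q - p q).
  apply: le_trans (lerD dsc pert) _.
  have c0 : 0 <= 1 - eta * lambda0 by rewrite subr_ge0.
  have h1 := ler_wpM2l c0 IH3.
  have h2 : eta * omega * zk <= eta * omega * z0 by rewrite ler_wpM2l// mulr_ge0// ltW.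
  apply: le_trans (lerD h1 h2) _.
  (* The fixed point of the map on the left is omega z0 / lambda_0. [D] exceeds it by |u(0)|, so the
     map does not increase [D] and the bound is uniform in k. *)
  have -> : (1 - eta * lambda0) * D + eta * omega * z0 =
     D - eta * lambda0 * (D - omega * z0 / lambda0).
    by field; rewrite lt0r_neq0.
  rewrite gerBl; apply: mulr_ge0; first by apply: mulr_ge0; exact: ltW.
  by rewrite /D addrK norm2_ge0.
Qed.

Lemma gd_convergence k :
  `| norm2 (fun i => u_pred eta x y a W0 k i - y i)
     - Num.sqrt (\sum_(i < n) (1 - eta * lam i) ^+ (2 * k) * (dotv (v i) y) ^+ 2) |
  <= norm2 (fun i => net a W0 (x i)) + omega * z0 / lambda0.
Proof.
have [_ _ h] := gd_invariant k.
rewrite -(norm2_linear_iter vorth Hdec eta y k); set p := linear_iter H eta y k in h *.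
rewrite -/(z k).
have t1 : norm2 (z k) <= norm2 p + norm2 (fun i => z k i - p i).
  apply: le_trans (norm2_triangle _ _).
  by rewrite le_eqVlt; apply/orP; left; apply/eqP; apply: eq_norm2 => i; rewrite addrC subrK.
have t2 : norm2 p <= norm2 (z k) + norm2 (fun i => z k i - p i).
  have -> : norm2 (fun i => z k i - p i) = norm2 (fun i => -1 * (z k i - p i)).
    by rewrite norm2Z normrN normr1 mul1r.
  apply: le_trans (norm2_triangle _ _).
  by rewrite le_eqVlt; apply/orP; left; apply/eqP; apply: eq_norm2 => i; ring.
apply: le_trans h; rewrite ler_norml; apply/andP; split; lra.
Qed.

End convergence.

(** * Moment bounds *)

Lemma markov_ge0 (R : realType) dT (T : measurableType dT) (P : probability T R)
    (Z : T -> R) (K a : R) : measurable_fun setT Z -> (forall t, 0 <= Z t) -> 0 < a ->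
  (\int[P]_t (Z t)%:E <= K%:E)%E ->
  measurable [set t | Z t <= a] /\ (P (~` [set t | (Z t <= a)%R]) <= (K / a)%:E)%E.
Proof.
move=> mZ Z0 a0 ZK.
have mA : measurable [set t | Z t <= a].
  rewrite (_ : [set t | _] = setT `&` Z @^-1` `]-oo, a]%classic).
    exact: mZ.
  by apply/seteqP; split => t /=; rewrite in_itv/=; [split|case].
split => //.
have mC : measurable (~` [set t | Z t <= a]) by exact: measurableC.
set C := ~` _ in mC *.
have : (a%:E * P C <= K%:E)%E.
  apply: le_trans ZK.
  have -> : (a%:E * P C = \int[P]_t (a * \1_C t)%:E)%E.
    under eq_integral do rewrite EFinM.
    rewrite ge0_integralZl_EFin//; last 2 first.
    - by apply/measurable_EFinP; exact: measurable_indic.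
    - exact: ltW.
    by rewrite integral_indic// setIT.
  apply: ge0_le_integral => //.
  - by move=> t _; rewrite lee_fin mulr_ge0// ltW.
  - by apply/measurable_EFinP; apply: measurable_funM => //; exact: measurable_indic.
  - by apply/measurable_EFinP.
  move=> t _; rewrite lee_fin indicE; have [tC|_] := boolP (t \in C); last by rewrite mulr0.
  rewrite mulr1; move: tC; rewrite inE /C /= => /negP; rewrite -ltNge; exact: ltW.
have : P C \is a fin_num by exact: fin_num_measure.
case: (P C) => // p _; rewrite -EFinM !lee_fin => h.
by rewrite ler_pdivlMr// mulrC.
Qed.

(* From u <= exp u with u = 3 x^2 / (8 k^2). *)
Lemma normal_pdf_sqr_le (R : realType) (k x : R) : 0 < k ->
  x ^+ 2 * normal_pdf 0 k x <= 6 * k ^+ 2 * normal_pdf 0 (2 * k) x.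
Proof.
move=> k0; have kn0 : k != 0 by rewrite lt0r_neq0.
have k2n0 : 2 * k != 0 by rewrite mulf_neq0// pnatr_eq0.
rewrite !normal_pdfE//.
rewrite /normal_fun /normal_peak !subr0.
have -> : Num.sqrt ((2 * k) ^+ 2 * pi *+ 2) = 2 * Num.sqrt (k ^+ 2 * pi *+ 2).
  rewrite exprMn -mulrA -mulrnAr sqrtrM ?sqr_ge0// sqrtr_sqr ger0_norm//.
set q := (Num.sqrt _)^-1.
have q0 : 0 <= q by rewrite invr_ge0 sqrtr_ge0.
rewrite invfM -/q.
pose u := 3 * x ^+ 2 / (8 * k ^+ 2).
have uE : - x ^+ 2 / ((2 * k) ^+ 2 *+ 2) = - x ^+ 2 / (k ^+ 2 *+ 2) + u.
  by rewrite /u; field.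
rewrite uE exp.expRD.
have ux : x ^+ 2 = 8 / 3 * k ^+ 2 * u by rewrite /u; field.
have ue : u <= expR u by apply: le_trans (expR_ge1Dx u); lra.
have e0 := expR_ge0 (- x ^+ 2 / (k ^+ 2 *+ 2)).
set E := expR (- _ / _) in e0 *.
have k20 : 0 <= k ^+ 2 := sqr_ge0 k.
have eu0 := expR_ge0 u.
have -> : 6 * k ^+ 2 * (2^-1 * q * (E * expR u)) = (q * E) * (3 * k ^+ 2 * expR u) by field.
rewrite [leLHS]mulrC.
apply: ler_wpM2l; first by rewrite mulr_ge0.
rewrite {1}ux; apply: (@le_trans _ _ (8 / 3 * k ^+ 2 * expR u)).
  by apply: ler_wpM2l => //; rewrite mulr_ge0//; lra.
by rewrite ler_wpM2r//; rewrite ler_wpM2r//; lra.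
Qed.

(** The exact value is k^2. A constant factor is harmless here, and domination by a multiple of a
    density, whose integral is one, avoids an integration by parts. *)
Lemma second_moment_normal (R : realType) (k : R) : 0 < k ->
  (\int[normal_prob 0 k]_x (x ^+ 2)%:E <= (6 * k ^+ 2)%:E)%E.
Proof.
move=> k0; have kn0 : k != 0 by rewrite lt0r_neq0.
have k2n0 : 2 * k != 0 by rewrite mulf_neq0// pnatr_eq0.
have m2 : measurable_fun [set: measurableTypeR R] (fun x : measurableTypeR R => (x ^+ 2)%:E).
  by apply/measurable_EFinP; exact: measurable_funX.
rewrite ge0_integral_normal_prob//; last by move=> x; rewrite lee_fin sqr_ge0.
have mp s : measurable_fun [set: measurableTypeR R]
    (fun x => (normal_pdf 0 s x)%:E) by
  apply/measurable_EFinP; exact: measurable_normal_pdf.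
apply: (@le_trans _ _ (\int[lebesgue_measure]_x ((6 * k ^+ 2)%:E * (normal_pdf 0 (2 * k) x)%:E)))%E.
  apply: ge0_le_integral => //.
  - by move=> x _; rewrite mule_ge0// lee_fin ?sqr_ge0 ?normal_pdf_ge0.
  - exact: emeasurable_funM.
  - by apply: emeasurable_funM => //; exact: measurable_cst.
  move=> x _; rewrite -!EFinM lee_fin; exact: normal_pdf_sqr_le.
rewrite ge0_integralZl_EFin//.
- by rewrite integral_normal_pdf mule1.
- by move=> x _; rewrite lee_fin normal_pdf_ge0.
- by rewrite mulr_ge0 ?sqr_ge0.
Qed.

Lemma normal_anticoncentration (R : realType) (k rad : R) : 0 < k -> 0 <= rad ->
  (normal_prob 0 k [set z : measurableTypeR R | (`|z| <= rad)%R] <= (rad / k)%:E)%E.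
Proof.
move=> k0 r0; have kn0 : k != 0 by rewrite lt0r_neq0.
have -> : [set z : measurableTypeR R | `|z| <= rad] = `[- rad, rad]%classic.
  by apply/seteqP; split => z /=; rewrite in_itv/= ler_norml.
rewrite /normal_prob.
have mp : measurable_fun (`[- rad, rad]%classic : set (measurableTypeR R))
    (fun x => (normal_pdf 0 k x)%:E).
  by apply: measurable_funTS; apply/measurable_EFinP; exact: measurable_normal_pdf.
apply: (@le_trans _ _ (\int[lebesgue_measure]_(x in `[(- rad)%R, rad]%classic) (normal_peak k)%:E)%E).
  apply: ge0_le_integral => //.
  - by move=> x _; rewrite lee_fin normal_pdf_ge0.
  - by move=> x _; rewrite lee_fin normal_pdf_ub.
rewrite integral_cst//= lebesgue_measure_itv/= lte_fin.
(* Since pi >= 2, the root of 2 pi k^2 is at least 2 k; times the length 2 rad this gives rad /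
   k. *)
have pk : normal_peak k <= (2 * k)^-1.
  rewrite /normal_peak lef_pV2 ?posrE ?mulr_gt0//; last first.
    by rewrite sqrtr_gt0 mulrn_wgt0// mulr_gt0 ?pi_gt0// exprn_gt0.
  have -> : 2 * k = Num.sqrt ((2 * k) ^+ 2) by rewrite sqrtr_sqr ger0_norm// mulr_ge0// ltW.
  rewrite ler_wsqrtr// exprMn -mulrnAr mulrC ler_wpM2l ?sqr_ge0//.
  by have := pi_ge2 R; rewrite -mulr_natr; lra.
case: ifP => _; last by rewrite mule0 lee_fin divr_ge0// ltW.
rewrite -EFinD -EFinM lee_fin opprK.
apply: (@le_trans _ _ ((2 * k)^-1 * (rad + rad))).
  by rewrite ler_wpM2r// addr_ge0.
by rewrite le_eqVlt; apply/orP; left; apply/eqP; field.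
Qed.

(** * Second moment of a sum of uncorrelated variables *)

Section uncorrelated.
Context (R : realType) dT (T : measurableType dT) (P : probability T R).
Local Notation mR := (measurableTypeR R).
Local Open Scope ereal_scope.

(** Under the product law Fubini applies, as both factors are integrable, and the inner integral
    over [g] vanishes. Centring one factor suffices, so a single random sign can play [g] while [f]
    carries the rest of a product. *)
Lemma integral_indep_centered (f g : T -> mR) :
  measurable_fun setT f -> measurable_fun setT g ->
  (forall A1 A2, measurable A1 -> measurable A2 ->
    P (f @^-1` A1 `&` g @^-1` A2) = P (f @^-1` A1) * P (g @^-1` A2)) ->
  P.-integrable setT (EFin \o f) -> P.-integrable setT (EFin \o g) ->
  \int[P]_t (g t)%:E = 0 ->
  \int[P]_t (f t * g t)%:E = 0.
Proof.
move=> mf mg ind intf intg g0.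
have mfg : measurable_fun setT (fun t => (f t, g t)) by exact: measurable_fun_pair.
pose f' : {mfun T >-> mR} := HB.pack f (isMeasurableFun.Build _ _ _ _ _ mf).
pose g' : {mfun T >-> mR} := HB.pack g (isMeasurableFun.Build _ _ _ _ _ mg).
pose M1 : probability mR R := distribution P f'.
pose M2 : probability mR R := distribution P g'.
pose F (z : mR * mR) : \bar R := (z.1 * z.2)%:E.
have mF : measurable_fun setT F by apply/measurable_EFinP; apply: measurable_funM.
have mEFin : measurable_fun [set: mR] (EFin : mR -> \bar R) by apply/measurable_EFinP; exact: measurable_id.
have M2g : M2.-integrable setT (EFin : mR -> \bar R).
  by apply: (integrable_pushforward mg).
have M2g0 : \int[M2]_y y%:E = 0.
  by rewrite -[RHS]g0; apply: (integral_pushforward mg).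
have lawE A : measurable A -> (M1 \x M2) A = pushforward P (fun t => (f t, g t)) A.
  pose fg' : {mfun T >-> (mR * mR)%type} := HB.pack (fun t => (f t, g t)) (isMeasurableFun.Build _ _ _ _ _ mfg).
  pose M12 : probability (mR * mR)%type R := distribution P fg'.
  have h : forall A1 A2, measurable A1 -> measurable A2 -> M12 (A1 `*` A2) = M1 A1 * M2 A2.
    by move=> A1 A2 mA1 mA2; exact: ind.
  by move=> mA; exact: (product_measure_unique h mA).
have intF : (M1 \x M2).-integrable setT F.
  apply/integrable12ltyP => //.
  rewrite (eq_integral (fun x : mR => `|x|%:E * \int[M2]_y `|y%:E|)); last first.
    move=> x _; rewrite -ge0_integralZl//.
    - by apply: eq_integral => y _; rewrite /F/= normrM EFinM.
    - exact: measurableT_comp.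
  have Mfin : \int[M2]_y `|y%:E| < +oo by move/integrableP : M2g => [].
  rewrite ge0_integralZr//.
  - apply: lte_mul_pinfty => //.
    + exact: integral_ge0.
    + rewrite ge0_fin_numE; last exact: integral_ge0.
      rewrite (ge0_integral_pushforward mf)//; first by move/integrableP : intf => [].
      by apply/measurable_EFinP; exact: normr_measurable.
  - by apply/measurable_EFinP; exact: normr_measurable.
  - exact: integral_ge0.
transitivity (\int[M1 \x M2]_z F z).
  transitivity (\int[pushforward P (fun t => (f t, g t))]_z F z).
    apply/esym; rewrite (integral_pushforward mfg)//.
    apply/integrableP; split; first by apply: (measurableT_comp mF mfg).
    rewrite -[ltLHS](@ge0_integral_pushforward _ _ _ _ _ _ mfg P setT (fun z => `|F z|))//.
      rewrite (eq_measure_integral (M1 \x M2)%E); first by move/integrableP : intF => [].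
      by move=> A mA _; exact/esym/lawE.
    exact: measurableT_comp.
  by apply: eq_measure_integral => A mA _; exact/esym/lawE.
rewrite -integral12_prod_meas1//.
rewrite (eq_integral (fun=> 0)) ?integral0// => x _.
rewrite /fubini_F /F/=; under eq_integral do rewrite EFinM.
by rewrite integralZl// M2g0 mule0.
Qed.

Lemma integral_sqr_sum_le (J : finType) (V : J -> T -> R) (K : R) :
  (forall r, measurable_fun setT (V r)) ->
  (forall r, \int[P]_t (V r t ^+ 2)%:E <= K%:E) ->
  (forall r s, r != s -> \int[P]_t (V r t * V s t)%:E = 0) ->
  \int[P]_t ((\sum_r V r t) ^+ 2)%:E <= (#|J|%:R * K)%:E.
Proof.
move=> mV VK V0.
have int2 r : P.-integrable setT (fun t => (V r t ^+ 2)%:E).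
  apply/integrableP; split; first by apply/measurable_EFinP; exact: measurable_funX.
  apply: (@le_lt_trans _ _ K%:E); last exact: ltry.
  apply: le_trans (VK r); rewrite le_eqVlt; apply/orP; left; apply/eqP.
  by apply: eq_integral => t _; rewrite /= ger0_norm// sqr_ge0.
have intVV r s : P.-integrable setT (fun t => (V r t * V s t)%:E).
  apply: (@le_integrable _ _ _ P setT measurableT _ (fun t => (V r t ^+ 2)%:E + (V s t ^+ 2)%:E)).
  - by apply/measurable_EFinP; exact: measurable_funM.
  - move=> t _; rewrite -EFinD !abse_EFin lee_fin [leRHS]ger0_norm ?addr_ge0 ?sqr_ge0//.
    by rewrite ler_norml; apply/andP; split; nra.
  - exact: integrableD.
rewrite (eq_integral (fun t => \sum_r \sum_s (V r t * V s t)%:E)); last first.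
  move=> t _; rewrite expr2 mulr_suml -sumEFin; apply: eq_bigr => r _.
  by rewrite mulr_sumr -sumEFin.
rewrite integral_sum//; last by move=> r; apply: integrable_sum.
apply: (@le_trans _ _ (\sum_(r in J) K%:E)).
  apply: lee_sum => r _; rewrite integral_sum//.
  rewrite (bigD1 r)//= big1 ?adde0; last by move=> s sr; rewrite V0// eq_sym.
  by apply: le_trans (VK r); under eq_integral do rewrite -expr2.
by rewrite sumEFin sumr_const mulr_natl lexx.
Qed.

End uncorrelated.

(** * Random initialization *)

Section initialization.
Context (dT : measure_display) (T : measurableType dT) (P : probability T RR).
Context (n m d : nat) (x : 'I_n -> 'I_d -> RR) (kappa : RR).
Context (W0 : T -> 'I_m -> 'I_d -> RR) (a0 : T -> 'I_m -> RR).
Local Notation mR := (measurableTypeR RR).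
Local Notation J := (('I_m * 'I_d) + 'I_m)%type.
Hypothesis x_unit : forall i, dotv (x i) (x i) = 1.
Hypothesis kappa_gt0 : 0 < kappa.
Hypothesis mW0 : forall r j, measurable_fun setT (fun t => W0 t r j : mR).
Hypothesis ma0 : forall r, measurable_fun setT (fun t => a0 t r : mR).
Hypothesis lawW0 : forall r j (B : set RR), @measurable _ mR B ->
  P ((fun t => W0 t r j) @^-1` B) = normal_prob 0 kappa B.
Hypothesis lawa1 : forall r, P ((fun t => a0 t r) @^-1` [set 1]) = (1 / 2)%:E.
Hypothesis lawaN1 : forall r, P ((fun t => a0 t r) @^-1` [set -1]) = (1 / 2)%:E.

Definition params (ij : J) : T -> RR :=
  match ij with
  | inl (r, j) => fun t => W0 t r j
  | inr r => fun t => a0 t r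
  end.
Hypothesis ind : mutually_independent P params.

Lemma measurable_params ij : measurable_fun setT (params ij : T -> mR).
Proof. by case: ij => [[r j]|r]; [exact: mW0|exact: ma0]. Qed.

Definition row_params (r : 'I_m) : {set J} := [set ij : J | if ij is inl p then p.1 == r else false]%SET.

Definition row_seq (r : 'I_m) : seq J := [seq inl (r, j) | j <- enum 'I_d].

(** The value 0 at the signs is a default: [row_seq] lists weights only. *)
Definition row_coef (u : 'I_d -> RR) (ij : J) : RR := if ij is inl p then u p.2 else 0.

Lemma row_seq_sum (r : 'I_m) (f : J -> RR) : \sum_(ij <- row_seq r) f ij = \sum_j f (inl (r, j)).
Proof. by rewrite /row_seq big_map big_enum. Qed.

Lemma measurable_preactivation (D : {set J}) r i : row_params r \subset D ->
  measurable_fun [set: cylinderType params D]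
    ((fun t => dotv (W0 t r) (x i)) : cylinderType params D -> mR).
Proof.
move=> rD; have -> : (fun t => dotv (W0 t r) (x i)) =
    (fun t => \sum_(ij <- row_seq r) params ij t * row_coef (x i) ij).
  by apply/funext => t; rewrite row_seq_sum.
apply: measurable_cylinder_sum => ij /mapP[j _ ->].
by apply: (fintype.subsetP rD); rewrite inE /=.
Qed.

Lemma measurable_preactivationT r i : measurable_fun setT (fun t => dotv (W0 t r) (x i) : mR).
Proof.
exact: (measurable_cylinder_fun measurable_params (measurable_preactivation i (subxx (row_params r)))).
Qed.

(** For unit inputs the Cholesky factor is explicit: al = 1, be is the scalar product rho of the
    inputs, and ga is the root of 1 - rho^2. *)
Lemma preactivation_law r i i' (f : mR * mR -> \bar RR) :
  measurable_fun setT f -> (forall z, 0 <= f z)%E ->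
  (\int[P]_t f (dotv (W0 t r) (x i), dotv (W0 t r) (x i')) =
   \int[normal_prob 0 kappa]_g1 \int[normal_prob 0 kappa]_g2
     f (g1, (dotv (x i) (x i') * g1 + Num.sqrt (1 - dotv (x i) (x i') ^+ 2) * g2)%R))%E.
Proof.
move=> mf f0.
have us : uniq (row_seq r) by rewrite map_inj_uniq ?enum_uniq// => j j' [].
have [|al [be [ga [[al0 ga0] h1 h2 h3 h4]]]] := gaussian_pair_law (k := kappa) (lt0r_neq0 kappa_gt0)
  measurable_params ind (row_coef (x i)) (row_coef (x i')) us.
  by move=> ij B /mapP[j _ ->] mB; exact: lawW0.
rewrite !row_seq_sum/= in h1 h2 h3.
have sq (u : 'I_d -> RR) : \sum_j u j ^+ 2 = dotv u u by apply: eq_bigr => j _; rewrite expr2.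
have al1 : al = 1.
  by rewrite -[LHS]ger0_norm// -sqrtr_sqr h1 sq x_unit sqrtr1.
have beE : be = dotv (x i) (x i') by rewrite -[be]mul1r -{1}al1 h2.
have gaE : ga = Num.sqrt (1 - dotv (x i) (x i') ^+ 2).
  rewrite -[LHS]ger0_norm// -sqrtr_sqr; congr Num.sqrt.
  by rewrite -beE -(x_unit i') -sq -h3; ring.
rewrite -gaE -beE.
transitivity (\int[P]_t f ((\sum_(j <- row_seq r) params j t * row_coef (x i) j)%R, (\sum_(j <- row_seq r) params j t * row_coef (x i') j)%R))%E.
  by apply: eq_integral => t _; rewrite !row_seq_sum.
rewrite (h4 f mf f0).
by apply: eq_integral => g1 _; apply: eq_integral => g2 _; rewrite al1 mul1r.
Qed.

Lemma preactivation_law1 r i (f : mR -> \bar RR) :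
  measurable_fun setT f -> (forall z, 0 <= f z)%E ->
  (\int[P]_t f (dotv (W0 t r) (x i)) = \int[normal_prob 0 kappa]_g f g)%E.
Proof.
move=> mf f0.
have mf1 : measurable_fun setT (fun z : mR * mR => f z.1) by apply: (measurableT_comp mf); exact: measurable_fst.
rewrite (preactivation_law r i i mf1 (fun z => f0 _)).
by apply: eq_integral => g _ /=; rewrite normal_integral_cst.
Qed.

Lemma flip_expectation r i rad : 0 <= rad ->
  (\int[P]_t (flip x (W0 t) rad r i)%:E <= (rad / kappa)%:E)%E.
Proof.
move=> rad0; apply: le_trans (normal_anticoncentration kappa_gt0 rad0).
have mA : measurable [set z : mR | `|z| <= rad].
  have -> : [set z : mR | `|z| <= rad] = `[- rad, rad]%classic.
    by apply/seteqP; split => z /=; rewrite in_itv/= ler_norml.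
  exact: measurable_itv.
have mf : measurable_fun setT (fun z : mR => (\1_[set z : mR | `|z| <= rad] z : RR)%:E).
  by apply/measurable_EFinP; exact: measurable_indic.
have f0 (z : mR) : (0 <= (\1_[set z : mR | (`|z| <= rad)%R] z : RR)%:E)%E by rewrite lee_fin.
rewrite (eq_integral (fun t => (\1_[set z : mR | `|z| <= rad] (dotv (W0 t r) (x i)) : RR)%:E)); last first.
  move=> t _; congr (_%:E); rewrite /flip indicE.
  by case: ifPn => h; [rewrite mem_set|rewrite memNset//; exact/negP].
rewrite (preactivation_law1 r i mf f0).
by rewrite integral_indic// setIT.
Qed.

Lemma measurable_flip r i rad : measurable_fun setT (fun t => flip x (W0 t) rad r i : mR).
Proof.
apply: measurable_fun_ifT; [|exact: measurable_cst|exact: measurable_cst].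
apply: measurable_fun_ler; last exact: measurable_cst.
have mn : measurable_fun [set: mR] (fun z : mR => `|z| : mR) by exact: normr_measurable.
exact: (measurableT_comp mn (measurable_preactivationT r i)).
Qed.

Lemma preactivation_second_moment r i :
  (\int[P]_t (relu (dotv (W0 t r) (x i)) ^+ 2)%:E <= (6 * kappa ^+ 2)%:E)%E.
Proof.
apply: le_trans (second_moment_normal kappa_gt0).
have m2 : measurable_fun setT (fun z : mR => (z ^+ 2)%:E).
  by apply/measurable_EFinP; exact: measurable_funX.
rewrite -(preactivation_law1 r i m2); last by move=> z; rewrite lee_fin sqr_ge0.
apply: ge0_le_integral => //.
- by move=> t _; rewrite lee_fin sqr_ge0.
- apply/measurable_EFinP; apply: measurable_funX; apply: measurable_maxr; last exact: measurable_cst.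
  exact: measurable_preactivationT.
- by apply: (measurableT_comp m2); exact: measurable_preactivationT.
- move=> t _; rewrite lee_fin /relu; have [h|h] := ltP (dotv (W0 t r) (x i)) 0; last by [].
  by rewrite expr0n sqr_ge0.
Qed.

(** The factor of [dotv (x i) (x j)] in [Hinf]. It is free of [kappa] because the event that both
    pre-activations are nonnegative is a cone. *)
Definition orthant_prob (i j : 'I_n) : RR := (pi - acos (dotv (x i) (x j))) / (2 * pi).

Lemma activation_indic w i : activation w (x i) = \1_[set z : mR | 0 <= z] (dotv w (x i)).
Proof.
rewrite /activation indicE; case: ifPn => h; first by rewrite mem_set.
by rewrite memNset//; exact/negP.
Qed.

Lemma activation_pair_expectation r i j :
  (\int[P]_t (activation (W0 t r) (x i) * activation (W0 t r) (x j))%:E = (orthant_prob i j)%:E)%E.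
Proof.
have mpos : measurable [set z : mR | 0 <= z] by exact: measurable_ge0.
have mind : measurable_fun setT (fun z : mR => \1_[set z : mR | 0 <= z] z : mR) by exact: measurable_indic.
pose f (z : mR * mR) : \bar RR := (\1_[set z : mR | 0 <= z] z.1 * \1_[set z : mR | 0 <= z] z.2)%:E.
have mf : measurable_fun setT f.
  by apply/measurable_EFinP; apply: measurable_funM; apply: measurableT_comp => //.
have f0 z : (0 <= f z)%E by rewrite lee_fin mulr_ge0.
transitivity (\int[P]_t f (dotv (W0 t r) (x i), dotv (W0 t r) (x j)))%E.
  by apply: eq_integral => t _; rewrite !activation_indic.
rewrite (preactivation_law r i j mf f0).
set p := dotv (x i) (x j); set q := Num.sqrt _.
have p1 : p ^+ 2 <= 1.
  have := norm_gram_le1 x_unit i j; rewrite -/p => h.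
  by rewrite -real_normK ?num_real// expr_le1.
have pq : p ^+ 2 + q ^+ 2 = 1 by rewrite /q sqr_sqrtr ?subr_ge0//; ring.
have := orthant_probability (lt0r_neq0 kappa_gt0) pq (sqrtr_ge0 _).
rewrite -/(orthant_prob i j) => <-.
have mO : measurable [set z : mR * mR | 0 <= z.1 /\ 0 <= p * z.1 + q * z.2].
  rewrite (_ : [set z | _] = ([set z : mR | 0 <= z] `*` setT) `&` [set z | 0 <= p * z.1 + q * z.2]).
    by apply: measurableI; [exact: measurableX|exact: measurable_lin2_ge0].
  by apply/seteqP; split => -[u v] /=; tauto.
have mO' : measurable_fun setT (fun z : mR * mR => (\1_[set z : mR * mR | 0 <= z.1 /\ 0 <= p * z.1 + q * z.2] z : RR)%:E).
  by apply/measurable_EFinP; exact: measurable_indic.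
transitivity (\int[normal_prob 0 kappa]_g1 \int[normal_prob 0 kappa]_g2
   (\1_[set z : mR * mR | (0 <= z.1)%R /\ (0 <= p * z.1 + q * z.2)%R] (g1, g2) : RR)%:E)%E.
  apply: eq_integral => g1 _; apply: eq_integral => g2 _; congr (_%:E).
  have mE (z : mR) : (z \in [set z : mR | 0 <= z]) = (0 <= z) by apply/idP/idP; rewrite inE.
  have mE2 : ((g1, g2) \in [set z : mR * mR | 0 <= z.1 /\ 0 <= p * z.1 + q * z.2]) =
      (0 <= g1) && (0 <= p * g1 + q * g2) by apply/idP/andP; rewrite inE.
  rewrite !indicE /= !mE mE2.
  by case: (0 <= g1); case: (0 <= _); rewrite ?mulr0 ?mul0r ?mulr1.
have E := product_normalE kappa mO' (fun z => _); rewrite -E; last by move=> z; rewrite lee_fin.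
have := @integral_indic _ _ _ (normal_prob 0 kappa \x normal_prob 0 kappa)%E _ measurableT _ mO.
by rewrite setIT => ->.
Qed.

Lemma measurable_activation (D : {set J}) r i : row_params r \subset D ->
  measurable_fun [set: cylinderType params D]
    ((fun t => activation (W0 t r) (x i)) : cylinderType params D -> mR).
Proof.
move=> rD; under eq_fun do rewrite activation_indic.
have mind : measurable_fun setT (fun z : mR => \1_[set z : mR | 0 <= z] z : mR).
  by apply: measurable_indic; exact: measurable_ge0.
exact: (measurableT_comp mind (measurable_preactivation i rD)).
Qed.

Lemma row_params_disjoint r s : r != s -> forall ij, ij \in row_params r -> ij \notin row_params s.
Proof. by move=> rs [[q j]|q]; rewrite !inE//= => /eqP ->. Qed.

Lemma orthant_prob01 i j : 0 <= orthant_prob i j <= 1.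
Proof.
have /ler_normlP[h1 h2] := norm_gram_le1 x_unit i j.
have h : -1 <= dotv (x i) (x j) <= 1 by apply/andP; split => //; lra.
have a0' := acos_ge0 h; have api := acos_lepi h; have p0 := pi_gt0 RR.
rewrite /orthant_prob divr_ge0 ?subr_ge0//=; last by rewrite mulr_ge0 ?ltW.
by rewrite ler_pdivrMr ?mulr_gt0//; lra.
Qed.

Definition pair_deviation (i j : 'I_n) (r : 'I_m) (t : T) : RR :=
  activation (W0 t r) (x i) * activation (W0 t r) (x j) - orthant_prob i j.

Lemma activation01 w i : activation w (x i) = 0 \/ activation w (x i) = 1.
Proof. by rewrite /activation; case: ifP; [right|left]. Qed.

Lemma measurable_pair_deviation i j r :
  measurable_fun [set: cylinderType params (row_params r)]
    (pair_deviation i j r : cylinderType params (row_params r) -> mR).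
Proof.
apply: measurable_funB; last exact: measurable_cst.
by apply: measurable_funM; exact: measurable_activation.
Qed.

Lemma pair_deviation_centered i j r :
  P.-integrable setT (EFin \o pair_deviation i j r) /\
  (\int[P]_t (pair_deviation i j r t)%:E = 0)%E.
Proof.
have mY := measurable_cylinder_fun measurable_params (@measurable_pair_deviation i j r).
have /andP[p0 p1] := orthant_prob01 i j.
have icst (c : RR) : P.-integrable setT (fun _ : T => c%:E) by exact: finite_measure_integrable_cst.
have iY : P.-integrable setT (EFin \o pair_deviation i j r).
  apply: (le_integrable measurableT _ _ (icst 1)); first by apply/measurable_EFinP.
  move=> t _; rewrite /= lee_fin normr1 /pair_deviation.
  case: (activation01 (W0 t r) i) => ->; case: (activation01 (W0 t r) j) => ->;
    rewrite ?mul0r ?mulr0 ?mul1r ler_norml; apply/andP; split; lra.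
split => //.
have E : (\int[P]_t (pair_deviation i j r t + orthant_prob i j)%:E = (orthant_prob i j)%:E)%E.
  rewrite -[RHS](activation_pair_expectation r).
  by apply: eq_integral => t _; rewrite /pair_deviation subrK.
move: E; under eq_integral do rewrite EFinD.
rewrite integralD// integral_cst// [X in (_ + _ * X)%E]probability_setT mule1.
have : (\int[P]_t (pair_deviation i j r t)%:E)%E \is a fin_num.
  exact: integrable_fin_num.
by case: (\int[P]_t _)%E => // q _; rewrite -EFinD => /eqP; rewrite eqe => /eqP h; congr (_%:E); lra.
Qed.

Hypothesis m_gt0 : (0 < m)%N.

Lemma gram_deviationE i j t : gram0 x (W0 t) i j - Hinf x i j =
  dotv (x i) (x j) / m%:R * \sum_r pair_deviation i j r t.
Proof.
rewrite /gram0 mxE /pair_deviation sumrB sumr_const card_ord.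
rewrite -mulr_sumr -(mulr_natr (orthant_prob i j) m) /orthant_prob.
have piN : pi != 0 :> RR := lt0r_neq0 (pi_gt0 _).
have mN : m%:R != 0 :> RR by rewrite pnatr_eq0 -lt0n.
have fE (q M s a p : RR) : M != 0 -> p != 0 ->
    M^-1 * (q * s) - q * a / (2 * p) = q / M * (s - a / (2 * p) * M).
  by move=> M0 p0; field; rewrite ?M0 ?p0.
exact: fE.
Qed.

(** Distinct rows are independent, so the m centred deviations, each at most 1 in absolute value,
    have a sum of second moment at most m; the prefactor contributes m^-2. *)
Lemma gram_deviation_second_moment i j :
  (\int[P]_t ((gram0 x (W0 t) i j - Hinf x i j) ^+ 2)%:E <= (m%:R^-1)%:E)%E.
Proof.
have mY r : measurable_fun setT (pair_deviation i j r : T -> mR) :=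
  measurable_cylinder_fun measurable_params (@measurable_pair_deviation i j r).
have mR0 : 0 < m%:R :> RR by rewrite ltr0n.
have sumle : (\int[P]_t ((\sum_r pair_deviation i j r t) ^+ 2)%:E <= (#|'I_m|%:R * 1)%:E)%E.
  apply: integral_sqr_sum_le => //.
  - move=> r; apply: (@le_trans _ _ (\int[P]_t (1 : RR)%:E)%E); last first.
      by rewrite integral_cst// [X in (_ * X)%E]probability_setT mule1.
    apply: ge0_le_integral => //.
    + by move=> t _; rewrite lee_fin sqr_ge0.
    + by apply/measurable_EFinP; apply: measurable_funX; exact: mY.
    + move=> t _; rewrite lee_fin /pair_deviation; have /andP[p0 p1] := orthant_prob01 i j.
      by case: (activation01 (W0 t r) i) => ->; case: (activation01 (W0 t r) j) => ->;
        rewrite ?mul0r ?mulr0 ?mul1r; nra.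
  - move=> r s rs; have [ir _] := pair_deviation_centered i j r.
    have [is' s0] := pair_deviation_centered i j s.
    apply: integral_indep_centered => //.
    move=> A1 A2 mA1 mA2.
    exact: (indep_preimage measurable_params ind (row_params_disjoint rs)
      (@measurable_pair_deviation i j r) (@measurable_pair_deviation i j s) mA1 mA2).
rewrite card_ord mulr1 in sumle.
apply: (@le_trans _ _ (\int[P]_t ((m%:R^-1 ^+ 2)%:E * ((\sum_r pair_deviation i j r t) ^+ 2)%:E))%E).
  have mS : measurable_fun setT (fun t => \sum_r pair_deviation i j r t : mR) by exact: measurable_sum.
  apply: ge0_le_integral => //.
  - by move=> t _; rewrite lee_fin sqr_ge0.
  - apply/measurable_EFinP; apply: measurable_funX.
    under eq_fun do rewrite gram_deviationE.
    by apply: measurable_funM => //; exact: measurable_cst.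
  - by apply: emeasurable_funM => //; apply/measurable_EFinP; exact: measurable_funX.
  move=> t _; rewrite -EFinM lee_fin gram_deviationE exprMn ler_wpM2r ?sqr_ge0//.
  rewrite exprMn ler_piMl ?sqr_ge0//.
  by rewrite -real_normK ?num_real// expr_le1// norm_gram_le1.
rewrite ge0_integralZl_EFin ?sqr_ge0//; last 2 first.
- by move=> t _; rewrite lee_fin sqr_ge0.
- by apply/measurable_EFinP; apply: measurable_funX; exact: measurable_sum.
apply: (@le_trans _ _ ((m%:R^-1 ^+ 2)%:E * (m%:R)%:E)%E).
  by apply: lee_wpmul2l => //; rewrite lee_fin sqr_ge0.
by rewrite -EFinM lee_fin expr2 -mulrA mulVf ?mulr1// lt0r_neq0.
Qed.

(* [a0] takes values in {-1, 1} only almost surely; [sign_of] is a version of it that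
   does so everywhere. *)
Definition sign_of (t : T) (r : 'I_m) : RR := 2 * \1_[set 1 : mR] (a0 t r) - 1.

Lemma sign_ofP t r : sign_of t r = 1 \/ sign_of t r = -1.
Proof.
rewrite /sign_of indicE; case: (_ \in _) => /=; [left|right]; ring.
Qed.

Lemma measurable_sign_of (D : {set J}) r : inr r \in D ->
  measurable_fun [set: cylinderType params D] ((fun t => sign_of t r) : cylinderType params D -> mR).
Proof.
move=> rD; apply: measurable_funB; last exact: measurable_cst.
apply: measurable_funM; first exact: measurable_cst.
have mi : measurable_fun setT (fun z : mR => \1_[set 1 : mR] z : mR).
  by apply: measurable_indic; exact: measurable_set1.
exact: (measurableT_comp mi (measurable_coordinate (X := params) rD)).
Qed.

Lemma sign_of_centered r :
  P.-integrable setT (EFin \o (fun t => sign_of t r)) /\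
  (\int[P]_t (sign_of t r)%:E = 0)%E.
Proof.
have m1 : measurable ((fun t => a0 t r) @^-1` [set 1]).
  by rewrite -[X in measurable X]setTI; apply: ma0 => //; exact: measurable_set1.
have mi : measurable_fun setT (fun t => sign_of t r : mR).
  apply: (measurable_cylinder_fun measurable_params (D := [set inr r]%SET)).
  by apply: measurable_sign_of; rewrite inE.
have icst (c : RR) : P.-integrable setT (fun _ : T => c%:E) by exact: finite_measure_integrable_cst.
have iS : P.-integrable setT (EFin \o (fun t => sign_of t r)).
  apply: (le_integrable measurableT _ _ (icst 1)); first by apply/measurable_EFinP.
  by move=> t _; rewrite /= lee_fin; case: (sign_ofP t r) => ->; rewrite ?normrN normr1.
split => //.
have E : (\int[P]_t (sign_of t r + 1)%:E = 1)%E.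
  transitivity (\int[P]_t (2%:E * (\1_((fun t => a0 t r) @^-1` [set 1]) t : RR)%:E))%E.
    apply: eq_integral => t _; rewrite -EFinM /sign_of subrK; congr (2 * _)%:E.
  rewrite ge0_integralZl_EFin//; last by apply/measurable_EFinP; exact: measurable_indic.
  by rewrite integral_indic// setIT [X in (_ * X)%E]lawa1 -EFinM; congr (_%:E); field.
move: E; under eq_integral do rewrite EFinD.
rewrite integralD// integral_cst// [X in (_ + _ * X)%E]probability_setT mule1.
have : (\int[P]_t (sign_of t r)%:E)%E \is a fin_num by exact: integrable_fin_num.
by case: (\int[P]_t _)%E => // q _; rewrite -EFinD => /eqP; rewrite eqe => /eqP h; congr (_%:E); lra.
Qed.

Definition unit_output (i : 'I_n) (r : 'I_m) (t : T) : RR :=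
  sign_of t r * relu (dotv (W0 t r) (x i)).

Lemma measurable_relu_preactivation (D : {set J}) r i : row_params r \subset D ->
  measurable_fun [set: cylinderType params D]
    ((fun t => relu (dotv (W0 t r) (x i))) : cylinderType params D -> mR).
Proof.
move=> rD; apply: measurable_maxr; last exact: measurable_cst.
exact: measurable_preactivation.
Qed.

Lemma measurable_unit_output i r : measurable_fun setT (unit_output i r : T -> mR).
Proof.
apply: (measurable_cylinder_fun measurable_params (D := [set: J]%SET)).
apply: measurable_funM; first by apply: measurable_sign_of; rewrite inE.
by apply: measurable_relu_preactivation; apply/fintype.subsetP => ij _; rewrite inE.
Qed.

Lemma output_second_moment i :
  (\int[P]_t (net (sign_of t) (W0 t) (x i) ^+ 2)%:E <= (6 * kappa ^+ 2)%:E)%E.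
Proof.
have mR0 : 0 < m%:R :> RR by rewrite ltr0n.
have relu2 r : P.-integrable setT (fun t => (relu (dotv (W0 t r) (x i)) ^+ 2)%:E).
  have mr : measurable_fun setT (fun t => relu (dotv (W0 t r) (x i)) ^+ 2 : mR).
    by apply: measurable_funX; apply: measurable_maxr; [exact: measurable_preactivationT|exact: measurable_cst].
  apply/integrableP; split; first exact/measurable_EFinP.
  apply: (@le_lt_trans _ _ (6 * kappa ^+ 2)%:E); last exact: ltry.
  apply: le_trans (preactivation_second_moment r i); rewrite le_eqVlt; apply/orP; left; apply/eqP.
  by apply: eq_integral => t _; rewrite /= ger0_norm// sqr_ge0.
have sumle : (\int[P]_t ((\sum_r unit_output i r t) ^+ 2)%:E <= (#|'I_m|%:R * (6 * kappa ^+ 2))%:E)%E.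
  apply: integral_sqr_sum_le.
  - by move=> r; exact: measurable_unit_output.
  - move=> r; apply: le_trans (preactivation_second_moment r i).
    rewrite le_eqVlt; apply/orP; left; apply/eqP; apply: eq_integral => t _.
    by rewrite /unit_output exprMn; case: (sign_ofP t r) => ->; rewrite ?sqrrN expr1n mul1r.
  - move=> r s rs.
    (* A cross term is the sign of neuron r times a function [f] of all the other parameters; that
       sign is centred and independent of them. *)
    pose D : {set J} := ~: [set inr r]%SET.
    have rD q : row_params q \subset D.
      by apply/fintype.subsetP => -[p|p]; rewrite !inE.
    pose f t : RR := relu (dotv (W0 t r) (x i)) * unit_output i s t.
    have mf : measurable_fun [set: cylinderType params D] (f : cylinderType params D -> mR).
      apply: measurable_funM; first exact: measurable_relu_preactivation.
      apply: measurable_funM; last exact: measurable_relu_preactivation.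
      by apply: measurable_sign_of; rewrite !inE; apply: contra rs => /eqP [->].
    have mg : measurable_fun [set: cylinderType params [set inr r]%SET] ((fun t => sign_of t r) : cylinderType params [set inr r]%SET -> mR).
      by apply: measurable_sign_of; rewrite inE.
    have mfT : measurable_fun setT (f : T -> mR) := measurable_cylinder_fun measurable_params mf.
    have mgT := measurable_cylinder_fun measurable_params mg.
    have [ig g0] := sign_of_centered r.
    transitivity (\int[P]_t (f t * sign_of t r)%:E)%E.
      by apply: eq_integral => t _; congr (_%:E); rewrite /f /unit_output; ring.
    apply: integral_indep_centered => //.
    + move=> A1 A2 mA1 mA2; apply: (indep_preimage measurable_params ind _ mf mg) => //.
      by move=> ij; rewrite !inE.
    + apply: (@le_integrable _ _ _ P setT measurableT _
        (fun t => (relu (dotv (W0 t r) (x i)) ^+ 2)%:E + (relu (dotv (W0 t s) (x i)) ^+ 2)%:E)%E).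
      * exact/measurable_EFinP.
      * move=> t _; rewrite /= lee_fin [leRHS]ger0_norm ?addr_ge0 ?sqr_ge0//.
        rewrite /f /unit_output ler_norml.
        set u := relu _; set w := relu _.
        by case: (sign_ofP t s) => ->; apply/andP; split; nra.
      * exact: integrableD.
rewrite card_ord in sumle.
have netE t : net (sign_of t) (W0 t) (x i) ^+ 2 = m%:R^-1 * (\sum_r unit_output i r t) ^+ 2.
  by rewrite /net exprMn exprVn sqr_sqrtr ?ler0n.
under eq_integral do rewrite netE EFinM.
rewrite ge0_integralZl_EFin ?invr_ge0 ?ler0n//; last 2 first.
- by move=> t _; rewrite lee_fin sqr_ge0.
- apply/measurable_EFinP; apply: measurable_funX; apply: measurable_sum => r.
  exact: measurable_unit_output.
apply: (@le_trans _ _ ((m%:R^-1)%:E * (m%:R * (6 * kappa ^+ 2))%:E)%E).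
  by apply: lee_wpmul2l => //; rewrite lee_fin invr_ge0 ler0n.
by rewrite -EFinM lee_fin mulKf// lt0r_neq0.
Qed.

Lemma integral_sum_le (I : finType) (f : I -> T -> RR) (K : RR) :
  (forall i, measurable_fun setT (f i : T -> mR)) -> (forall i t, 0 <= f i t) ->
  (forall i, \int[P]_t (f i t)%:E <= K%:E)%E ->
  (\int[P]_t (\sum_i f i t)%:E <= (#|I|%:R * K)%:E)%E.
Proof.
move=> mf f0 fK; under eq_integral do rewrite -sumEFin.
rewrite (@ge0_integral_sum _ _ _ P setT measurableT _ (fun i t => (f i t)%:E)); last 2 first.
- by move=> i; apply/measurable_EFinP; exact: mf.
- by move=> i t _; rewrite lee_fin.
apply: (@le_trans _ _ (\sum_(i in I) K%:E)%E); first exact: lee_sum.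
by rewrite sumEFin sumr_const mulr_natl lexx.
Qed.

(** Indicator of the null event that [a0] is neither 1 nor -1; in this form the event is excluded by
    the same Markov bound as the others. *)
Definition unsigned (r : 'I_m) (t : T) : RR := 1 - \1_([set 1] `|` [set -1] : set mR) (a0 t r).

Lemma measurable_unsigned r : measurable_fun setT (unsigned r : T -> mR).
Proof.
apply: measurable_funB; first exact: measurable_cst.
have mi : measurable_fun setT (fun z : mR => \1_([set 1] `|` [set -1] : set mR) z : mR).
  by apply: measurable_indic; apply: measurableU; exact: measurable_set1.
exact: (measurableT_comp mi (ma0 r)).
Qed.

Lemma unsigned_ge0 r t : 0 <= unsigned r t.
Proof. by rewrite /unsigned indicE; case: (_ \in _); rewrite ?subrr ?subr0. Qed.

Lemma unsigned_expectation r : (\int[P]_t (unsigned r t)%:E <= 0%:E)%E.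
Proof.
have m1 (c : RR) : measurable ((fun t => a0 t r) @^-1` [set c]).
  by rewrite -[X in measurable X]setTI; apply: ma0 => //; exact: measurable_set1.
pose A := (fun t => a0 t r) @^-1` [set 1] `|` (fun t => a0 t r) @^-1` [set -1].
have mA : measurable A by exact: measurableU.
have PA : P A = 1%E.
  rewrite measureU//; last first.
    by apply/seteqP; split => t //= [-> h]; lra.
  rewrite [X in (X + _)%E]lawa1 [X in (_ + X)%E]lawaN1 -EFinD; congr (_%:E); lra.
have icst (c : RR) : P.-integrable setT (fun _ : T => c%:E) by exact: finite_measure_integrable_cst.
rewrite (eq_integral (fun t => 1%:E - (\1_A t : RR)%:E)%E); last first.
  by move=> t _; rewrite -EFinB.
rewrite integralB//; last exact: integrable_indic.
have -> : (\int[P]_t (\1_A t : RR)%:E = 1)%E.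
  by rewrite integral_indic// setIT; exact: PA.
by rewrite integral_cst// [X in (_ * X - _)%E]probability_setT mule1 -EFinB subrr.
Qed.

Lemma probability_setCI (A B : set T) (a b : RR) : measurable A -> measurable B ->
  (P (~` A) <= a%:E -> P (~` B) <= b%:E -> P (~` (A `&` B)) <= (a + b)%:E)%E.
Proof.
move=> mA mB Aa Bb; rewrite setCI EFinD.
by apply: le_trans (measureU2 _ _ _) _; rewrite ?leeD//; exact: measurableC.
Qed.

(** Each of the three thresholds is 3 / delta times the bound on the corresponding expectation, so
    each event costs delta / 3; the signs cost nothing. *)
Lemma good_event (delta rad : RR) : 0 < delta -> 0 < rad -> (0 < n)%N ->
  exists A : set T, [/\ measurable A, ((1 - delta)%:E <= P A)%E &
   forall t, A t ->
   [/\ forall r, a0 t r = 1 \/ a0 t r = -1,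
       \sum_i net (a0 t) (W0 t) (x i) ^+ 2 <= 18 * n%:R * kappa ^+ 2 / delta,
       \sum_i \sum_j (gram0 x (W0 t) i j - Hinf x i j) ^+ 2 <= 3 * n%:R ^+ 2 / (m%:R * delta) &
       \sum_i flips x (W0 t) rad i <= 3 * n%:R * m%:R * rad / (kappa * delta)]].
Proof.
move=> d0 r0 n0.
have nR : 0 < n%:R :> RR by rewrite ltr0n.
have mR0 : 0 < m%:R :> RR by rewrite ltr0n.
have p0 : forall i, measurable_fun setT (fun t => net (sign_of t) (W0 t) (x i) ^+ 2 : mR).
  move=> i; apply: measurable_funX; apply: measurable_funM; first exact: measurable_cst.
  by apply: measurable_sum => r; exact: measurable_unit_output.
have p1 : forall ij : 'I_n * 'I_n, measurable_fun setT (fun t => (gram0 x (W0 t) ij.1 ij.2 - Hinf x ij.1 ij.2) ^+ 2 : mR).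
  move=> ij; apply: measurable_funX; under eq_fun do rewrite gram_deviationE.
  apply: measurable_funM; first exact: measurable_cst.
  apply: measurable_sum => r.
  exact: (measurable_cylinder_fun measurable_params (@measurable_pair_deviation ij.1 ij.2 r)).
(* The sum counts neurons, so staying below any threshold in (0, 1), here 1 / 2, means that it is
   0. *)
have [mA0 PA0] := @markov_ge0 RR _ _ P (fun t => \sum_r unsigned r t) (#|'I_m|%:R * 0) (1 / 2)
  (measurable_sum _ (fun r => measurable_unsigned r)) (fun t => sumr_ge0 _ (fun r _ => unsigned_ge0 r t)) (divr_gt0 ltr01 (ltr0Sn _ 1))
  (integral_sum_le measurable_unsigned unsigned_ge0 unsigned_expectation).
have [] := @markov_ge0 RR _ _ P (fun t => \sum_i net (sign_of t) (W0 t) (x i) ^+ 2)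
  (#|'I_n|%:R * (6 * kappa ^+ 2)) (18 * n%:R * kappa ^+ 2 / delta).
- exact: measurable_sum.
- by move=> t; apply: sumr_ge0 => i _; exact: sqr_ge0.
- by rewrite divr_gt0// mulr_gt0 ?exprn_gt0// mulr_gt0.
- by apply: integral_sum_le => // [i t|i]; [exact: sqr_ge0|exact: output_second_moment].
move=> mA1 PA1.
have [] := @markov_ge0 RR _ _ P (fun t => \sum_(ij : 'I_n * 'I_n) (gram0 x (W0 t) ij.1 ij.2 - Hinf x ij.1 ij.2) ^+ 2)
  (#|{: 'I_n * 'I_n}|%:R * m%:R^-1) (3 * n%:R ^+ 2 / (m%:R * delta)).
- exact: measurable_sum.
- by move=> t; apply: sumr_ge0 => i _; exact: sqr_ge0.
- by rewrite divr_gt0 ?mulr_gt0 ?exprn_gt0.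
- by apply: integral_sum_le => // [i t|i]; [exact: sqr_ge0|exact: gram_deviation_second_moment].
move=> mA2 PA2.
have [] := @markov_ge0 RR _ _ P (fun t => \sum_(ir : 'I_n * 'I_m) flip x (W0 t) rad ir.2 ir.1)
  (#|{: 'I_n * 'I_m}|%:R * (rad / kappa)) (3 * n%:R * m%:R * rad / (kappa * delta)).
- by apply: measurable_sum => ir; exact: measurable_flip.
- by move=> t; apply: sumr_ge0 => i _; exact: flip_ge0.
- by rewrite divr_gt0 ?mulr_gt0.
- apply: integral_sum_le => [i|i t|i]; [exact: measurable_flip|exact: flip_ge0|].
  exact: flip_expectation (ltW r0).
move=> mA3 PA3.
set A0 := [set t | _] in mA0 PA0; set A1 := [set t | _] in mA1 PA1.
set A2 := [set t | _] in mA2 PA2; set A3 := [set t | _] in mA3 PA3.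
have mA01 := measurableI _ _ mA0 mA1; have mA23 := measurableI _ _ mA2 mA3.
exists ((A0 `&` A1) `&` (A2 `&` A3)); split; first exact: measurableI.
  have := probability_setCI mA01 mA23 (probability_setCI mA0 mA1 PA0 PA1) (probability_setCI mA2 mA3 PA2 PA3).
  rewrite probability_setC; last exact: measurableI.
  have : P ((A0 `&` A1) `&` (A2 `&` A3)) \is a fin_num by apply: fin_num_measure; exact: measurableI.
  case: (P _) => // q _; rewrite -EFinB !lee_fin => h.
  suff E : #|'I_m|%:R * 0 / (1 / 2) + #|'I_n|%:R * (6 * kappa ^+ 2) / (18 * n%:R * kappa ^+ 2 / delta) +
    (#|{: 'I_n * 'I_n}|%:R * m%:R^-1 / (3 * n%:R ^+ 2 / (m%:R * delta)) +
     #|{: 'I_n * 'I_m}|%:R * (rad / kappa) / (3 * n%:R * m%:R * rad / (kappa * delta))) = delta.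
    by rewrite E in h; lra.
  rewrite !card_prod !card_ord !natrM.
  by field; rewrite !lt0r_neq0.
move=> t [[h0 h1] [h2 h3]].
have sgn r : a0 t r = 1 \/ a0 t r = -1.
  have : unsigned r t <= 1 / 2.
    apply: le_trans h0; rewrite (bigD1 r)//= lerDl; apply: sumr_ge0 => q _; exact: unsigned_ge0.
  rewrite /unsigned indicE; case: (boolP (_ \in _)) => [|_ /=]; first by rewrite inE.
  by rewrite subr0; lra.
have aE : a0 t = sign_of t.
  apply/funext => r; rewrite /sign_of indicE.
  case: (sgn r) => ->; first by rewrite mem_set//=; ring.
  rewrite memNset/=; first by ring.
  by move=> h; lra.
split => //.
- by rewrite aE.
- by rewrite pair_big.
- by move: h3; rewrite /A3/= -(pair_big xpredT xpredT (fun i r => flip x (W0 t) rad r i)).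
Qed.

End initialization.

(** * Choice of the constants *)

Ltac positivity := repeat match goal with
  | H : is_true (0 < ?a)%R |- is_true (0 < ?a)%R => exact: H
  | |- is_true (0 < _ ^+ _)%R => apply: exprn_gt0
  | |- is_true (0 < _ / _)%R => apply: divr_gt0
  | |- is_true (0 < _ * _)%R => apply: mulr_gt0
  | |- is_true (0 < 1)%R => exact: ltr01
  | |- is_true (0 < _)%R => exact: ltr0Sn
  | |- is_true (0 <= _)%R => apply: ltW
  end.

Lemma sqr_le_le (R : realDomainType) (a b : R) : 0 <= b -> a ^+ 2 <= b ^+ 2 -> a <= b.
Proof.
move=> b0 ab; case: (leP a b) => // ba; move: ab; rewrite leNgt.
by rewrite ltrXn2r ?ba ?orbT.
Qed.

Section parameters.
(* nu, mu, de are the square roots of n, m, delta. *)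
Variables nu mu de lambda0 kappa eps : RR.
Hypothesis nu_gt0 : 0 < nu.
Hypothesis nu_ge1 : 1 <= nu.
Hypothesis mu_gt0 : 0 < mu.
Hypothesis de_gt0 : 0 < de.
Hypothesis de_le1 : de <= 1.
Hypothesis lambda0_gt0 : 0 < lambda0.
Hypothesis lambda0_le : lambda0 <= nu ^+ 2.
Hypothesis kappa_gt0 : 0 < kappa.
Hypothesis kappa_le1 : kappa <= 1.
Hypothesis eps_gt0 : 0 < eps.

(** The scale n^3 / (sqrt m delta^(3/2) lambda_0 kappa) of the flip term. The final omega is 110
    times it: 2 for the Gram deviation and 108 for the flips. *)
Definition perturbation : RR := nu ^+ 6 / (mu * de ^+ 3 * lambda0 * kappa).

Lemma perturbation_gt0 : 0 < perturbation.
Proof. by rewrite /perturbation; positivity. Qed.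

(** The Gram deviation is of lower order, n / sqrt(m delta): the remaining factor of [perturbation]
    is at least 1 by [lambda0_le], [nu_ge1], [de_le1] and [kappa_le1]. The constant uses 3 <=
    2^2. *)
Lemma perturbation_gram :
  3 * (nu ^+ 2) ^+ 2 / (mu ^+ 2 * de ^+ 2) <= (2 * perturbation) ^+ 2.
Proof.
have q1 : nu ^+ 2 / (mu * de) <= perturbation.
  have -> : perturbation = (nu ^+ 2 / (mu * de)) * (nu ^+ 4 / (de ^+ 2 * lambda0 * kappa)).
    by rewrite /perturbation; field; rewrite !lt0r_neq0.
  rewrite ler_pMr; last by positivity.
  rewrite ler_pdivlMr; last by positivity.
  rewrite mul1r; have h2 : nu ^+ 2 <= nu ^+ 4 by rewrite ler_weXn2l.
  apply: le_trans h2; apply: le_trans lambda0_le.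
  apply: (@le_trans _ _ (de ^+ 2 * lambda0)).
    by rewrite ler_piMr//; positivity.
  by rewrite ler_piMl ?(ltW lambda0_gt0)// expr_le1// ltW.
have -> : 3 * (nu ^+ 2) ^+ 2 / (mu ^+ 2 * de ^+ 2) = 3 * (nu ^+ 2 / (mu * de)) ^+ 2.
  by field; rewrite !lt0r_neq0.
have q0 : 0 <= nu ^+ 2 / (mu * de) by positivity.
have : (nu ^+ 2 / (mu * de)) ^+ 2 <= perturbation ^+ 2.
  by rewrite ler_pXn2r ?nnegrE// ltW// perturbation_gt0.
by rewrite exprMn; have := sqr_ge0 perturbation; lra.
Qed.

(** 108 = 3 * 3 * 12, from the weights of [omega_ge], the share delta / 3 of the flip event, and the
    radius. *)
Lemma perturbation_flips :
  3 * nu ^+ 2 * (3 * nu ^+ 2 * mu ^+ 2 * (12 * nu ^+ 2 / (mu * de * lambda0)) / (kappa * de ^+ 2)) / mu ^+ 2 =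
  108 * perturbation.
Proof. by rewrite /perturbation; field; rewrite !lt0r_neq0. Qed.

Lemma perturbation_le_gap :
  2 * 10 ^+ 6 * ((nu ^+ 2) ^+ 6 / (lambda0 ^+ 4 * kappa ^+ 2 * (de ^+ 2) ^+ 3)) <= mu ^+ 2 ->
  110 * perturbation <= lambda0 / 2.
Proof.
move=> muge; pose q : RR := nu ^+ 6 / (lambda0 ^+ 2 * kappa * de ^+ 3).
have q0 : 0 < q by rewrite /q; positivity.
have h : 1320 * q <= mu.
  apply: sqr_le_le (ltW mu_gt0) _.
  apply: le_trans muge.
  have <- : q ^+ 2 = (nu ^+ 2) ^+ 6 / (lambda0 ^+ 4 * kappa ^+ 2 * (de ^+ 2) ^+ 3).
    by rewrite /q; field; rewrite !lt0r_neq0.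
  rewrite exprMn.
  by apply: ler_wpM2r; [positivity|lra].
have -> : 110 * perturbation = 110 * q * (lambda0 / mu).
  by rewrite /q /perturbation; field; rewrite !lt0r_neq0.
have lm : 0 < lambda0 / mu by positivity.
apply: (@le_trans _ _ (mu / 12 * (lambda0 / mu))).
  by rewrite ler_pM2r//; lra.
have -> : mu / 12 * (lambda0 / mu) = lambda0 / 12 by field; rewrite lt0r_neq0.
by have := lambda0_gt0; lra.
Qed.

(** This inequality fixes C: it amounts to 2 * 6 * 110 q <= mu, and 1320^2 <= 2 * 10^6. *)
Lemma perturbation_le_eps :
  2 * 10 ^+ 6 * ((nu ^+ 2) ^+ 7 / (lambda0 ^+ 4 * kappa ^+ 2 * (de ^+ 2) ^+ 4 * eps ^+ 2)) <= mu ^+ 2 ->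
  110 * perturbation * (6 * (nu / de)) / lambda0 <= eps / 2.
Proof.
move=> muge; pose q : RR := nu ^+ 7 / (lambda0 ^+ 2 * kappa * de ^+ 4 * eps).
have q0 : 0 < q by rewrite /q; positivity.
have h : 1320 * q <= mu.
  apply: sqr_le_le (ltW mu_gt0) _.
  apply: le_trans muge.
  have <- : q ^+ 2 = (nu ^+ 2) ^+ 7 / (lambda0 ^+ 4 * kappa ^+ 2 * (de ^+ 2) ^+ 4 * eps ^+ 2).
    by rewrite /q; field; rewrite !lt0r_neq0.
  rewrite exprMn.
  by apply: ler_wpM2r; [positivity|lra].
have -> : 110 * perturbation * (6 * (nu / de)) / lambda0 = 660 * q * (eps / mu).
  by rewrite /q /perturbation; field; rewrite !lt0r_neq0.
have em : 0 < eps / mu by positivity.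
apply: (@le_trans _ _ (mu / 2 * (eps / mu))).
  by rewrite ler_pM2r//; lra.
by rewrite le_eqVlt; apply/orP; left; apply/eqP; field; rewrite lt0r_neq0.
Qed.

Lemma initial_output_le_eps : kappa <= 1 / 10 * (eps * de ^+ 2 / nu) ->
  17 / 4 * (nu * kappa / de) <= eps / 2.
Proof.
move=> kappa_le.
have kap : nu * kappa <= 1 / 10 * (eps * de ^+ 2).
  by move: kappa_le; rewrite mulrA ler_pdivlMr// mulrC.
apply: (@le_trans _ _ (17 / 4 * (1 / 10 * (eps * de ^+ 2) / de))).
  by apply: ler_wpM2l; [positivity|rewrite ler_wpM2r// invr_ge0; positivity].
have -> : 17 / 4 * (1 / 10 * (eps * de ^+ 2) / de) = 17 / 40 * (eps * de) by field; rewrite lt0r_neq0.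
have : eps * de <= eps by rewrite ler_piMr// ltW.
by have := eps_gt0; lra.
Qed.

(** 17 / 4 is a rational upper bound of sqrt 18, since 18 = 288 / 16. It is small enough that 17 /
    40 <= 1 / 2 when c = 1 / 10, and 17 / 4 + 1 <= 6. *)
Lemma initial_output_bound :
  18 * nu ^+ 2 * kappa ^+ 2 / de ^+ 2 <= (17 / 4 * (nu * kappa / de)) ^+ 2.
Proof.
pose q : RR := nu ^+ 2 * kappa ^+ 2 / de ^+ 2.
have q0 : 0 < q by rewrite /q; positivity.
have -> : (17 / 4 * (nu * kappa / de)) ^+ 2 = 289 / 16 * q.
  by rewrite /q; field; rewrite lt0r_neq0.
have -> : 18 * nu ^+ 2 * kappa ^+ 2 / de ^+ 2 = 18 * q by rewrite /q; ring.
by lra.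
Qed.

Lemma initial_residual_bound : 17 / 4 * (nu * kappa / de) + nu <= 6 * (nu / de).
Proof.
have h2 : nu <= nu / de by rewrite ler_pdivlMr// ler_piMr// ltW.
have h3 : nu * kappa / de <= nu / de.
  by rewrite ler_wpM2r ?invr_ge0 ?(ltW de_gt0)// ler_piMr// ltW.
have h4 : 0 < nu / de by positivity.
by lra.
Qed.

End parameters.

Lemma ex_sqrt (a : RR) : 0 < a -> exists s : RR, [/\ 0 < s, a = s ^+ 2 & Num.sqrt a = s].
Proof.
by move=> a0; exists (Num.sqrt a); split; rewrite ?sqrtr_gt0// sqr_sqrtr// ltW.
Qed.

Lemma Hinf_trace (n d : nat) (x : 'I_n -> 'I_d -> RR) :
  (forall i, dotv (x i) (x i) = 1) -> \tr (Hinf x) = n%:R / 2.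
Proof.
move=> x_unit; rewrite /mxtrace.
transitivity (\sum_(i < n) (2^-1 : RR)).
  apply: eq_bigr => i _; rewrite mxE x_unit acos1 subr0 mul1r.
  by rewrite invfM mulrCA divff ?mulr1// lt0r_neq0// pi_gt0.
by rewrite sumr_const card_ord -[LHS]mulr_natl.
Qed.

Theorem theorem4p1 :
  exists c C : RR, 0 < c /\ 0 < C /\
  forall (n d : nat) (x : 'I_n -> 'I_d -> RR) (y : 'I_n -> RR),
  (forall i, dotv (x i) (x i) = 1) ->
  (forall i, `|y i| <= 1) ->
  forall lambda0 : RR,
  eigenvalue (Hinf x) lambda0 ->
  (forall mu : RR, eigenvalue (Hinf x) mu -> lambda0 <= mu) ->
  0 < lambda0 ->
  forall (lam : 'I_n -> RR) (v : 'I_n -> 'I_n -> RR),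
  (forall i j, dotv (v i) (v j) = (i == j)%:R) ->
  (forall p q, Hinf x p q = \sum_(i < n) lam i * v i p * v i q) ->
  forall (eps delta kappa eta : RR) (m : nat),
  0 < eps -> 0 < delta -> delta < 1 ->
  0 < kappa -> kappa <= 1 ->
  0 < eta ->
  kappa <= c * (eps * delta / Num.sqrt (n%:R)) ->
  m%:R >= C * Num.max
     (n%:R ^+ 7 / (lambda0 ^+ 4 * kappa ^+ 2 * delta ^+ 4 * eps ^+ 2))
     (n%:R ^+ 6 / (lambda0 ^+ 4 * kappa ^+ 2 * delta ^+ 3)) ->
  eta <= c * (lambda0 / n%:R ^+ 2) ->
  forall (dT : measure_display) (T : measurableType dT) (P : probability T RR)
         (W0 : T -> 'I_m -> 'I_d -> RR) (a0 : T -> 'I_m -> RR),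
  (forall r j, measurable_fun setT (fun t => W0 t r j : measurableTypeR RR)) ->
  (forall r, measurable_fun setT (fun t => a0 t r : measurableTypeR RR)) ->
  (forall r j (B : set RR), @measurable _ (measurableTypeR RR) B ->
     P ((fun t => W0 t r j) @^-1` B) = normal_prob 0 kappa B) ->
  (forall r, P ((fun t => a0 t r) @^-1` [set 1]) = (1 / 2)%:E) ->
  (forall r, P ((fun t => a0 t r) @^-1` [set -1]) = (1 / 2)%:E) ->
  mutually_independent P
    (fun ij : ('I_m * 'I_d) + 'I_m =>
       match ij with
       | inl (r, j) => fun t => W0 t r j
       | inr r => fun t => a0 t r
       end) ->
  exists A : set T, measurable A /\ ((1 - delta)%:E <= P A)%E /\
    forall t, A t -> forall k : nat,
      `| norm2 (fun i => u_pred eta x y (a0 t) (W0 t) k i - y i)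
         - Num.sqrt (\sum_(i < n) (1 - eta * lam i) ^+ (2 * k) * (dotv (v i) y) ^+ 2) |
      <= eps.
Proof.
exists (1 / 10), (2 * 10 ^+ 6); split; first by lra.
split; first by lra.
move=> n d x y x_unit y1 lambda0 lambda0_eig lambda0_min lambda0_gt0 lam v vorth Hdec.
move=> eps delta kappa eta m eps0 delta0 delta1 kappa0 kappa1 eta0 kappa_le m_ge eta_le.
move=> dT T P W0 a0 mW0 ma0 lawW0 lawa1 lawaN1 ind.
(* For n = 0 the only row vector is zero, so [lambda0] could not be an eigenvalue. *)
have n_gt0 : (0 < n)%N.
  move: lambda0_eig => /eigenvalueP[u _]; case: (n) u => // u /eqP; case.
  by apply/rowP => -[].
have nR0 : 0 < n%:R :> RR by rewrite ltr0n.
have m_gt0 : (0 < m)%N.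
  rewrite -(ltr_nat RR); apply: lt_le_trans m_ge.
  apply: mulr_gt0; first by positivity.
  by rewrite lt_max; apply/orP; left; positivity.
have mR0 : 0 < m%:R :> RR by rewrite ltr0n.
have C0 : 0 < 2 * 10 ^+ 6 :> RR by positivity.
have mA : 2 * 10 ^+ 6 * (n%:R ^+ 7 / (lambda0 ^+ 4 * kappa ^+ 2 * delta ^+ 4 * eps ^+ 2)) <= m%:R.
  by apply: le_trans m_ge; rewrite (ler_pM2l C0) le_max lexx.
have mB : 2 * 10 ^+ 6 * (n%:R ^+ 6 / (lambda0 ^+ 4 * kappa ^+ 2 * delta ^+ 3)) <= m%:R.
  by apply: le_trans m_ge; rewrite (ler_pM2l C0) le_max lexx orbT.
have lam_ge i : lambda0 <= lam i by apply: lambda0_min; exact: lam_eigenvalue.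
have sumlam : \sum_i lam i = n%:R / 2 by rewrite (sum_lam vorth Hdec) Hinf_trace.
have lam_le i : lam i <= n%:R / 2.
  rewrite -sumlam (bigD1 i)//= lerDl; apply: sumr_ge0 => j _.
  by apply: le_trans (lam_ge j); exact: ltW.
have l0n : lambda0 <= n%:R / 2 by apply: le_trans (lam_ge (Ordinal n_gt0)) (lam_le _).
(* The product is at most lambda_0 / (20 n), and lambda_0 <= n / 2. *)
have eta_n : eta * (n%:R / 2) <= 1.
  apply: (@le_trans _ _ (1 / 10 * (lambda0 / n%:R ^+ 2) * (n%:R / 2))).
    by apply: ler_wpM2r => //; positivity.
  have -> : 1 / 10 * (lambda0 / n%:R ^+ 2) * (n%:R / 2) = lambda0 / (20 * n%:R).
    by move: (n%:R : RR) nR0 => N N0; field; rewrite lt0r_neq0.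
  by rewrite ler_pdivrMr; [lra|positivity].
have eta_lam i : eta * lam i <= 1.
  by apply: le_trans eta_n; apply: ler_wpM2l; [exact: ltW|exact: lam_le].
have eta_lambda0 : eta * lambda0 <= 1.
  by apply: le_trans eta_n; apply: ler_wpM2l; [exact: ltW|exact: l0n].
have [nu [nu0 nuE sqn]] := ex_sqrt nR0.
have [mu [mu0 muE sqm]] := ex_sqrt mR0.
have [de [de0 deE _]] := ex_sqrt delta0.
have de1 : de <= 1.
  by rewrite -(ler_pXn2r (_ : (0 < 2)%N)) ?nnegrE ?(ltW de0)// -deE expr1n ltW.
have nu1 : 1 <= nu.
  by rewrite -(ler_pXn2r (_ : (0 < 2)%N)) ?nnegrE ?(ltW nu0)// -nuE expr1n (ler_nat _ 1).
have l0nu : lambda0 <= nu ^+ 2 by rewrite -nuE; lra.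
(* The distance 2 sqrt n |z(0)| / (sqrt m lambda0) of gd_convergence, when |z(0)| is
   replaced by its bound 6 nu / de. *)
pose rad : RR := 12 * nu ^+ 2 / (mu * de * lambda0).
have rad0 : 0 < rad by rewrite /rad; positivity.
have [A [mesA PA goodA]] := good_event x_unit kappa0 mW0 ma0 lawW0 lawa1 lawaN1 ind m_gt0 delta0 rad0 n_gt0.
exists A; split => //; split => // t At k.
have [a_sign out_le gram_le flips_le] := goodA t At.
rewrite nuE muE deE in mA mB out_le gram_le flips_le.
rewrite sqn deE in kappa_le.
have out1 : norm2 (fun i => net (a0 t) (W0 t) (x i)) <= 17 / 4 * (nu * kappa / de).
  apply: norm2_le; first by positivity.
  exact: le_trans out_le (initial_output_bound nu0 de0 kappa0).
have z0_le : norm2 (residual x y (a0 t) (W0 t)) <= 6 * (nu / de).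
  have -> : norm2 (residual x y (a0 t) (W0 t)) = norm2 (fun i => net (a0 t) (W0 t) (x i) + -1 * y i).
    by apply: eq_norm2 => i; rewrite /residual mulN1r.
  apply: le_trans (norm2_triangle _ _) _.
  apply: le_trans (initial_residual_bound nu0 de0 de1 kappa1).
  apply: lerD => //; rewrite norm2Z normrN normr1 mul1r.
  apply: norm2_le (ltW nu0) _; rewrite -nuE -[X in _ <= X%:R]card_ord -sumr_const.
  by apply: ler_sum => i _; rewrite -real_normK ?num_real// expr_le1.
have rad_ge : 2 * Num.sqrt n%:R * norm2 (residual x y (a0 t) (W0 t)) / (Num.sqrt m%:R * lambda0) <= rad.
  rewrite sqn sqm.
  apply: (@le_trans _ _ (2 * nu * (6 * (nu / de)) / (mu * lambda0))).
    apply: ler_wpM2r; first by rewrite invr_ge0; positivity.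
    by apply: ler_wpM2l => //; positivity.
  rewrite /rad le_eqVlt; apply/orP; left; apply/eqP.
  by field; rewrite !lt0r_neq0.
pose Q := perturbation nu mu de lambda0 kappa.
have Q0 : 0 < Q by exact: perturbation_gt0.
have omega_ge : Num.sqrt (\sum_i \sum_j (gram0 x (W0 t) i j - Hinf x i j) ^+ 2) +
    3 * n%:R * (\sum_i flips x (W0 t) rad i) / m%:R <= 110 * Q.
  have -> : 110 * Q = 2 * Q + 108 * Q by ring.
  apply: lerD.
    rewrite -(ler_pXn2r (_ : (0 < 2)%N)) ?nnegrE ?sqrtr_ge0//; last by positivity.
    rewrite sqr_sqrtr; last by apply: sumr_ge0 => i _; apply: sumr_ge0 => j _; exact: sqr_ge0.
    by apply: le_trans gram_le _; exact: perturbation_gram.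
  rewrite nuE muE -perturbation_flips//.
  apply: ler_wpM2r; first by rewrite invr_ge0; positivity.
  by apply: ler_wpM2l => //; positivity.
have omega_le : 110 * Q <= lambda0 / 2 by exact: perturbation_le_gap.
apply: le_trans (gd_convergence x_unit a_sign m_gt0 eta0 vorth Hdec lambda0_gt0 lam_ge eta_lam eta_lambda0 rad_ge omega_ge omega_le k) _.
rewrite [leRHS]splitr; apply: lerD.
  apply: le_trans out1 _; exact: initial_output_le_eps.
apply: (@le_trans _ _ (110 * Q * (6 * (nu / de)) / lambda0)); last exact: perturbation_le_eps.
apply: ler_wpM2r; first by rewrite invr_ge0; positivity.
by apply: ler_wpM2l => //; positivity.
Qed.
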